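(* Let $X$ be a $k$-simply connected LG-rigid graph with cocompact group of isometries. There exists $R$ such that the following holds. If $(Y_n)$ is a sequence of finite graphs such that a proportion $1-o(1)$ (as $n\to\infty$) of the balls of radius $R$ in $Y_n$ are isometric to a ball in $X$, and such that $(Y_n)$ is asymptotically $k$-simply connected, then for every $R'$, a proportion $1-o(1)$ of the balls of radius $R'$ in $Y_n$ are isometric to a ball in $X$.
   Context: A ''graph'' means a connected, locally finite graph without loops or multiple edges, equipped with the geodesic metric giving each edge length $1$; ''$x\in X$'' means that $x$ is a vertex of $X$; balls are closed balls, centered at vertices and equipped with their intrinsic geodesic metrics; proportions are with respect to the uniform measure on the vertices (centers) of $Y_n$, and a ball of radius $\rho$ in $Y_n$ is compared with balls of the same radius $\rho$ in $X$. The isometry group is cocompact if it has finitely many orbits of vertices. A covering from a graph $X$ to a graph $Y$ is a graph covering map (a surjective graph morphism which, for every vertex $x$, maps the neighbors of $x$ bijectively onto the neighbors of its image); $Y$ is covered by $X$ if such a map $X\to Y$ exists. Given a graph $X$ and $R>0$, a graph $Y$ is $R$-locally $X$ if for every vertex $y\in Y$ there exists $x\in X$ such that $B_X(x,R)$ and $B_Y(y,R)$ are isometric. $X$ is LG-rigid at scale $R$ if every graph which is $R$-locally $X$ is covered by $X$. $X$ is LG-rigid if it is LG-rigid at scale $R$ for some $R>0$. For a graph $X$ and $k\in\mathbf{N}$, $P_k(X)$ is the 2-dimensional CW-complex whose 1-skeleton is $X$ and whose 2-cells are $m$-gons, $0\le m\le k$, one attached along each simple loop of length $m$ in $X$ (up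 to cyclic permutations). $X$ is $k$-simply connected if $P_k(X)$ is simply connected. A sequence of graphs $(Y_n)$ is asymptotically $k$-simply connected if for every $l\in\mathbf{N}$ there exists $L\in\mathbf{N}$ such that for $n$ large enough, every loop of length at most $l$ in $Y_n$ bounds a disc of diameter at most $L$ in $P_k(Y_n)$. *)

(* Defs.v *)
From HB Require Import structures.
From mathcomp Require Import all_boot all_order all_algebra finmap.
From mathcomp Require Import all_classical all_reals all_analysis.
Import Order.TTheory GRing.Theory Num.Theory numFieldNormedType.Exports.
Set Implicit Arguments.
Unset Strict Implicit.
Unset Printing Implicit Defensive.
Local Open Scope classical_set_scope.
Local Open Scope ring_scope.

Record graph := Graph {
  vertex :> choiceType;
  adj : rel vertex;
  adj_sym : symmetric adj;
  adj_irr : irreflexive adj;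
  adj_lfin : forall x, finite_set [set y | adj x y];
  adj_conn : forall x y, exists2 p, path adj x p & last x p = y;
  vertex_inh : exists _ : vertex, True }.

Definition is_covering (X Y : graph) (f : X -> Y) : Prop :=
  (forall y, exists x, f x = y) /\
  forall x, set_bij [set x' | adj x x'] [set y' | adj (f x) y'] f.

Definition covered_by (Y X : graph) : Prop := exists f : X -> Y, is_covering f.

(* Points of geometric realizations are given by their barycentric
   coordinates. *)
Section Barycentric.
Variables (R : realType) (T : Type).

Definition vertex_pt (a : T) : T -> R := \1_[set a].

Definition edge_pt (a b : T) (t : R) : T -> R :=
  fun i => (1 - t) * vertex_pt a i + t * vertex_pt b i.

Definition triangle_pt (c a b : T) (s t : R) : T -> R :=
  fun i => s * vertex_pt c i + (1 - s) * edge_pt a b t i.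

(* The walk x :: p travelled at unit speed, at a time s in [0, size p]. *)
Definition walk_pt (x : T) (p : seq T) (s : R) : T -> R :=
  let i := Num.truncn s in
  edge_pt (nth x (x :: p) i) (nth x (x :: p) i.+1) (s - i%:R).

End Barycentric.

Section Metric.
Variables (R : realType) (X : graph).

Definition realization : set (X -> R) :=
  [set p | (exists u, p = vertex_pt R u) \/
           exists u v t, [/\ adj u v, 0 <= t <= 1 & p = edge_pt u v t]].

(* polyline A p q l: some path from p to q inside A, made of finitely many
   segments of edges, has length l. *)
Inductive polyline (A : set (X -> R)) : (X -> R) -> (X -> R) -> R -> Prop :=
| polyline_nil p : A p -> polyline A p p 0
| polyline_cons u v s t q l :
    adj u v -> 0 <= s <= 1 -> 0 <= t <= 1 ->
    (forall c, Num.min s t <= c <= Num.max s t -> A (edge_pt u v c)) ->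
    polyline A (edge_pt u v t) q l ->
    polyline A (edge_pt u v s) q (`|s - t| + l).

Definition intrinsic_dist (A : set (X -> R)) (p q : X -> R) : R :=
  inf [set l | polyline A p q l].

Definition gdist : (X -> R) -> (X -> R) -> R := intrinsic_dist realization.

Definition vdist (x y : X) : R := gdist (vertex_pt R x) (vertex_pt R y).

Definition gball (x : X) (r : R) : set (X -> R) :=
  [set p | realization p /\ gdist (vertex_pt R x) p <= r].

Definition is_isometry (g : X -> X) : Prop :=
  bijective g /\ forall x y, vdist (g x) (g y) = vdist x y.

Definition cocompact : Prop :=
  exists F : set X, finite_set F /\
    forall x, exists g z, [/\ is_isometry g, F z & g z = x].

End Metric.

(* A ball is a pointed space: isometries between balls map center to center. *)
Definition isometric_balls (R : realType) (X Y : graph) (x : X) (y : Y)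
    (r : R) : Prop :=
  exists f : (X -> R) -> (Y -> R),
    [/\ set_bij (gball x r) (gball y r) f,
        f (vertex_pt R x) = vertex_pt R y &
        forall p q, gball x r p -> gball x r q ->
          intrinsic_dist (gball y r) (f p) (f q) =
          intrinsic_dist (gball x r) p q].

(* The vertices y of Y whose r-ball is isometric to an r-ball of X. *)
Definition good_centers (R : realType) (X Y : graph) (r : R) : set Y :=
  [set y | exists x : X, isometric_balls x y r].

Definition is_locally (R : realType) (r : R) (X Y : graph) : Prop :=
  forall y : Y, good_centers X r y.

Definition LG_rigid_at (R : realType) (r : R) (X : graph) : Prop :=
  forall Y : graph, is_locally r X Y -> covered_by Y X.

Definition LG_rigid (R : realType) (X : graph) : Prop :=
  exists2 r : R, 0 < r & LG_rigid_at r X.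

Definition finite_graph (Y : graph) : Prop := finite_set [set: Y].

Definition good_proportion (R : realType) (X Y : graph) (r : R) : R :=
  #|` fset_set (good_centers X r : set Y)|%:R / #|` fset_set [set: Y]|%:R.

(* A simple loop is given by its successive vertices; there is none with
   fewer than 3 vertices since the graph has no loops or multiple edges. *)
Definition simple_loop (X : graph) (k : nat) (w : seq X) : Prop :=
  [/\ (3 <= size w <= k)%N, uniq w & cycle (@adj X) w].

(* Two-cells are indexed by cyclic words. *)
Definition cyclic_word (T : Type) (w : seq T) : set (seq T) :=
  [set w' | exists i, w' = rot i w].

Section Polygonal.
Variables (R : realType) (k : nat) (X : graph).

(* An m-gon is the cone over its boundary, that is, m triangles with a common
   apex inr c, where c is the index of the 2-cell. *)
Definition Pk_index : Type := X + set (seq X).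

Definition Pk_vertex (u : X) : Pk_index -> R :=
  vertex_pt R (inl u : Pk_index).

Definition Pk_edge (u v : X) (t : R) : Pk_index -> R :=
  edge_pt (inl u : Pk_index) (inl v) t.

Definition Pk_triangle (w : seq X) (u : X) (z : R * R) : Pk_index -> R :=
  triangle_pt (inr (cyclic_word w) : Pk_index) (inl u) (inl (next w u)) z.1 z.2.

Definition unit_square : set (R * R) := `[0, 1]%classic `*` `[0, 1]%classic.

Definition Pk_points : set (Pk_index -> R) :=
  [set p | [\/ exists u, p = Pk_vertex u,
               exists u v t, [/\ adj u v, `[0, 1]%classic t & p = Pk_edge u v t]
             | exists w u z, [/\ simple_loop k w, u \in w, unit_square z
                               & p = Pk_triangle w u z]]].

Record Pk := MkPk { Pk_coord : Pk_index -> R; Pk_coordP : Pk_points Pk_coord }.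

HB.instance Definition _ := gen_eqMixin Pk.
HB.instance Definition _ := gen_choiceMixin Pk.

(* Weak topology: a set is open when its trace on each closed cell is. *)
Definition Pk_preimage (Z : Type) (phi : Z -> Pk_index -> R) (U : set Pk) :
  set Z := [set z | exists2 p, U p & Pk_coord p = phi z].

Definition Pk_open (U : set Pk) : Prop :=
  (forall u v, adj u v ->
     open (Pk_preimage (Pk_edge u v) U : set (subspace `[0, 1]%classic))) /\
  (forall w u, simple_loop k w -> u \in w ->
     open (Pk_preimage (Pk_triangle w u) U : set (subspace unit_square))).

Lemma Pk_coord_inj : injective Pk_coord.
Proof.
move=> [p pP] [q qP] /= pq; move: qP; rewrite -pq => qP.
by rewrite (Prop_irrelevance pP qP).
Qed.

Lemma Pk_preimageI Z (phi : Z -> Pk_index -> R) A B :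
  Pk_preimage phi (A `&` B) = Pk_preimage phi A `&` Pk_preimage phi B.
Proof.
apply/seteqP; split=> z /=; first by move=> [p [Ap Bp] e]; split; exists p.
move=> [[p Ap e] [q Bq e']]; exists p => //; split=> //.
by rewrite (Pk_coord_inj (etrans e (esym e'))).
Qed.

Lemma Pk_preimage_bigcup Z (phi : Z -> Pk_index -> R) I (f : I -> set Pk) :
  Pk_preimage phi (\bigcup_i f i) = \bigcup_i Pk_preimage phi (f i).
Proof.
apply/seteqP; split=> z /=; first by move=> [p [i _ fp] e]; exists i => //; exists p.
by move=> [i _ [p fp e]]; exists p => //; exists i.
Qed.

Lemma open_subspaceS (T : topologicalType) (A B : set T) :
  A `<=` B -> open (B : set (subspace A)).
Proof.
move=> AB; apply/open_subspaceP; exists setT; first exact: openT.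
by rewrite setTI setIidr.
Qed.

Lemma Pk_openT : Pk_open setT.
Proof.
split=> [u v uv|w u w_loop uw]; apply: open_subspaceS => z zI.
- have pz : Pk_points (Pk_edge u v z) by apply: Or32; exists u, v, z.
  by exists (MkPk pz).
- have pz : Pk_points (Pk_triangle w u z) by apply: Or33; exists w, u, z.
  by exists (MkPk pz).
Qed.

Lemma Pk_openI A B : Pk_open A -> Pk_open B -> Pk_open (A `&` B).
Proof.
move=> [A1 A2] [B1 B2]; split=> [u v uv|w u w_loop uw]; rewrite Pk_preimageI.
- by apply: openI; [exact: A1|exact: B1].
- by apply: openI; [exact: A2|exact: B2].
Qed.

Lemma Pk_open_bigU (I : Type) (f : I -> set Pk) :
  (forall i, Pk_open (f i)) -> Pk_open (\bigcup_i f i).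
Proof.
move=> fo; split=> [u v uv|w u w_loop uw]; rewrite Pk_preimage_bigcup.
- by apply: bigcup_open => i _; apply: (fo i).1.
- by apply: bigcup_open => i _; apply: (fo i).2.
Qed.

HB.instance Definition _ :=
  isOpenTopological.Build Pk Pk_openT Pk_openI Pk_open_bigU.

(* The vertices of the smallest closed cell containing p. *)
Definition carrier (p : Pk) : set X :=
  [set u | 0 < Pk_coord p (inl u) \/
           exists w : seq X, 0 < Pk_coord p (inr (cyclic_word w)) /\ u \in w].

(* H is a disc in polar coordinates: H (s, 0) runs along the boundary and
   H (s, 1) is the center. *)
Definition bounds_disc (x : X) (p : seq X) (L : nat) : Prop :=
  let D : set (R * R) := `[0, (size p)%:R]%classic `*` `[0, 1]%classic in
  exists H : R * R -> Pk,
    [/\ {within D, continuous H},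
        forall s, 0 <= s <= (size p)%:R ->
          Pk_coord (H (s, 0)) = walk_pt (inl x : Pk_index) (map inl p) s,
        forall t, 0 <= t <= 1 -> H (0, t) = H ((size p)%:R, t),
        forall s, 0 <= s <= (size p)%:R -> H (s, 1) = H (0, 1) &
        forall z z' u u', D z -> D z' ->
          carrier (H z) u -> carrier (H z') u' -> vdist R u u' <= L%:R].

End Polygonal.

Definition path_connected (R : realType) (T : topologicalType) : Prop :=
  forall a b : T, exists g : R -> T,
    [/\ {within `[0, 1], continuous g}, g 0 = a & g 1 = b].

Definition null_homotopic (R : realType) (T : topologicalType) (g : R -> T) :
    Prop :=
  exists H : R * R -> T,
    [/\ {within @unit_square R, continuous H},
        forall s, 0 <= s <= 1 -> H (s, 0) = g s,
        forall t, 0 <= t <= 1 -> H (0, t) = g 0 /\ H (1, t) = g 0 &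
        forall s, 0 <= s <= 1 -> H (s, 1) = g 0].

Definition simply_connected (R : realType) (T : topologicalType) : Prop :=
  path_connected R T /\
  forall g : R -> T,
    {within `[0, 1], continuous g} -> g 0 = g 1 -> null_homotopic g.

Definition k_simply_connected (R : realType) (k : nat) (X : graph) : Prop :=
  simply_connected R (Pk R k X).

Definition asymptotically_k_simply_connected (R : realType) (k : nat)
    (Y : nat -> graph) : Prop :=
  forall l : nat, exists L : nat, \forall n \near \oo,
    forall (x : Y n) (p : seq (Y n)),
      path (@adj (Y n)) x p -> last x p = x -> (size p <= l)%N ->
      bounds_disc R k x p L.

(* Main.v *)
Require Import Defs.
From HB Require Import structures.
From mathcomp Require Import all_boot all_order all_algebra finmap.
From mathcomp Require Import generic_quotient.
From mathcomp Require Import all_classical all_reals all_analysis.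
From mathcomp Require Import zify lra.
Import Order.TTheory GRing.Theory Num.Theory numFieldNormedType.Exports.
Set Implicit Arguments.
Unset Strict Implicit.
Unset Printing Implicit Defensive.
Local Open Scope classical_set_scope.
Local Open Scope ring_scope.

(** If the conclusion fails for some radius, there are vertices [y m] of
    [Y (n m)] around which all [N]-balls up to distance [m] are good but whose
    own larger ball is bad.  The ultraproduct [Z] of the graphs pointed at
    [y m] is then locally [X], hence covered by [X], and the covering [f] is
    injective on balls of a fixed radius because it cannot decrease the
    cardinality of the smallest balls of [X].  If [f a = f b], a path from [a]
    to [b] projects to a loop of [Z], which is also a loop of some [Y (n m)]
    and bounds a disc of controlled diameter there.  Discretizing the disc, the
    loops of the resulting grid are pairwise close, so their lifts to [X] all
    close up, and [a = b].  Hence [X] and [Z] are isomorphic, and the larger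
    ball around [y m] is good for many [m], a contradiction.  So every vertex
    with a bad large ball is within distance [m] of a vertex with a bad
    [N]-ball, and bounded degrees turn this into a comparison of proportions. *)

(** * Combinatorial distance *)

Section CombinatorialDistance.
Variable X : graph.
Implicit Types (x y z : X) (n m : nat).

Definition linked x y n : Prop :=
  exists2 p : seq X, path (@adj X) x p & last x p = y /\ size p = n.

Lemma exists_linked x y : exists n, `[< linked x y n >].
Proof. by have [p px pl] := adj_conn x y; exists (size p); apply/asboolP; exists p. Qed.

Definition cdist x y : nat := ex_minn (exists_linked x y).

Lemma cdist_path x y :
  exists2 p, path (@adj X) x p & last x p = y /\ size p = cdist x y.
Proof. by rewrite /cdist; case: ex_minnP => n /asboolP. Qed.

Lemma path_cdist x p : path (@adj X) x p -> (cdist x (last x p) <= size p)%N.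
Proof.
by move=> xp; rewrite /cdist; case: ex_minnP => n _; apply; apply/asboolP; exists p.
Qed.

Lemma cdistxx x : cdist x x = 0%N.
Proof. by have := @path_cdist x [::] isT; rewrite leqn0 => /eqP. Qed.

Lemma cdist_eq0 x y : cdist x y = 0%N -> x = y.
Proof. by move=> e; have [[|a p] _ []] := cdist_path x y; rewrite ?e. Qed.

Lemma cdist_triangle y x z : (cdist x z <= cdist x y + cdist y z)%N.
Proof.
have [p px [pl <-]] := cdist_path x y; have [q qy [ql <-]] := cdist_path y z.
rewrite -size_cat -ql -pl -last_cat; apply: path_cdist.
by rewrite cat_path px pl.
Qed.

Lemma cdist_adj x y : adj x y -> (cdist x y <= 1)%N.
Proof. by move=> xy; apply: (@path_cdist x [:: y]); rewrite /= xy. Qed.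

Lemma cdist_sym x y : cdist x y = cdist y x.
Proof.
suff le x' y' : (cdist x' y' <= cdist y' x')%N by apply/eqP; rewrite eqn_leq !le.
have [p px [<- <-]] := cdist_path y' x'; elim: p y' px => [|a p ih] z /=.
  by rewrite cdistxx.
move=> /andP[za /ih le_p]; rewrite -addn1.
apply: leq_trans (cdist_triangle a _ _) _.
by rewrite leq_add// cdist_adj// adj_sym.
Qed.

Lemma cdist1 x y : cdist x y = 1%N -> adj x y.
Proof.
move=> e; have [[|a [|b p]]] /= := cdist_path x y; rewrite e => xa [] // <- _.
by rewrite andbT in xa.
Qed.

Lemma adj_cdist x y : adj x y = (cdist x y == 1)%N.
Proof.
apply/idP/eqP => [xy|/cdist1//]; apply/eqP; rewrite eqn_leq cdist_adj//= lt0n.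
by apply/eqP => /cdist_eq0 e; move: xy; rewrite e adj_irr.
Qed.

(** Allowing [z = x] makes this work with any upper bound on the distance instead of its exact
    value; such bounds are what inductions and the ultraproduct provide. *)
Lemma cdist_step n x y : (cdist x y <= n.+1)%N ->
  exists2 z, z = x \/ adj x z & (cdist z y <= n)%N.
Proof.
have [[|a p] /=] := cdist_path x y.
  by move=> _ [<- _] _; exists x; [left|rewrite cdistxx].
move=> /andP[xa ap] [<- <-] pn; exists a; first by right.
by apply: leq_trans (path_cdist ap) _.
Qed.

Lemma cdist_pred x y : (0 < cdist x y)%N ->
  exists2 z, adj z y & cdist x y = (cdist x z).+1.
Proof.
move=> xy; have [|z zy zx] := @cdist_step (cdist x y).-1 y x.
  by rewrite cdist_sym prednK.
have tri := cdist_triangle z x y; have sxz := cdist_sym x z.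
case: zy => [e|yz]; first by move: zx; rewrite e cdist_sym; lia.
have := cdist_adj yz; rewrite cdist_sym => zy1.
by exists z; [rewrite adj_sym|lia].
Qed.

Lemma cdist_adj_le x y z : adj y z -> (cdist x z <= (cdist x y).+1)%N.
Proof.
by move=> /cdist_adj yz; apply: leq_trans (cdist_triangle y _ _) _; rewrite -addn1 leq_add2l.
Qed.

Lemma path_cdist_nth x p i : path (@adj X) x p -> (i <= size p)%N ->
  (cdist x (nth x (x :: p) i) <= i)%N.
Proof.
elim: p x i => [|a p ih] x [|i] /=; rewrite ?cdistxx//.
move=> /andP[xa ap] ip; apply: leq_trans (cdist_triangle a _ _) _.
by rewrite -add1n leq_add ?cdist_adj// (set_nth_default a)//; apply: ih.
Qed.

End CombinatorialDistance.

(** * Distance from a vertex in the geometric realization *)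

Section EdgePoints.
Variables (R : realType) (T : choiceType).
Implicit Types (u v : T) (t : R).

Lemma vertex_ptE u i : vertex_pt R u i = (i == u)%:R.
Proof.
rewrite /vertex_pt indicE; congr (_%:R); congr nat_of_bool.
by apply/idP/eqP => [/set_mem //|->]; apply/mem_set.
Qed.

Lemma vertex_pt_inj : injective (@vertex_pt R T).
Proof.
move=> u v /(congr1 (fun f => f u)); rewrite !vertex_ptE eqxx.
by case: eqP => // _ /eqP; rewrite oner_eq0.
Qed.

Lemma edge_pt0 u v : edge_pt u v 0 = vertex_pt R u.
Proof. by apply/funext => i; rewrite /edge_pt subr0 mul1r mul0r addr0. Qed.

Lemma edge_pt1 u v : edge_pt u v 1 = vertex_pt R v.
Proof. by apply/funext => i; rewrite /edge_pt subrr mul1r mul0r add0r. Qed.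

Lemma edge_ptC u v t : edge_pt u v t = edge_pt v u (1 - t).
Proof. by apply/funext => i; rewrite /edge_pt opprB addrC (addrC t) addrA subrr add0r addrC. Qed.

Lemma edge_ptl u v t : u != v -> edge_pt u v t u = 1 - t.
Proof. by rewrite /edge_pt !vertex_ptE eqxx => /negbTE->; rewrite mulr1 mulr0 addr0. Qed.

Lemma edge_ptr u v t : u != v -> edge_pt u v t v = t.
Proof. by rewrite /edge_pt !vertex_ptE eqxx eq_sym => /negbTE->; rewrite mulr1 mulr0 add0r. Qed.

Lemma edge_pt_supp u v t i : i != u -> i != v -> edge_pt u v t i = 0.
Proof. by rewrite /edge_pt !vertex_ptE => /negbTE-> /negbTE->; rewrite !mulr0 addr0. Qed.

End EdgePoints.

Lemma adj_neq (X : graph) (u v : X) : adj u v -> u != v.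
Proof. by apply: contraTneq => ->; rewrite adj_irr. Qed.

Section Height.
Variables (R : realType) (X : graph).
Implicit Types (x y u v : X) (p q : X -> R) (s t c h l : R).

Lemma realization_vertex u : @realization R X (vertex_pt R u).
Proof. by left; exists u. Qed.

Lemma realization_edge u v t : adj u v -> 0 <= t <= 1 ->
  @realization R X (edge_pt u v t).
Proof. by move=> uv t01; right; exists u, v, t. Qed.

(** A point of an edge with weight [p u] at its end [u] lies at distance [1 - p u] from [u], so on
    the realization this formula is the geodesic distance from [x]. Only vertices of the support, at
    most two, compete. *)
Definition height x p : R :=
  inf [set (cdist x u)%:R + 1 - p u | u in [set u | 0 < p u]].

Lemma height_eq x p u : 0 < p u ->
  (forall v, 0 < p v -> (cdist x u)%:R + 1 - p u <= (cdist x v)%:R + 1 - p v) ->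
  height x p = (cdist x u)%:R + 1 - p u.
Proof.
move=> pu min_u; apply/eqP; rewrite eq_le; apply/andP; split.
  apply: ge_inf; last by exists u.
  by exists ((cdist x u)%:R + 1 - p u) => _ [v pv <-]; apply: min_u.
apply: lb_le_inf; first by exists ((cdist x u)%:R + 1 - p u), u.
by move=> _ [v pv <-]; apply: min_u.
Qed.

Lemma height_vertex x u : height x (vertex_pt R u) = (cdist x u)%:R.
Proof.
have e : vertex_pt R u u = 1 by rewrite vertex_ptE eqxx.
rewrite (@height_eq _ _ u) e ?addrK// => v.
by rewrite vertex_ptE; case: eqP => [->|]; rewrite ?ltxx// !addrK.
Qed.

Lemma cdist_edge x u v : adj u v ->
  `|(cdist x u)%:R - (cdist x v)%:R| <= 1 :> R.
Proof.
move=> uv; have := cdist_adj_le x uv; rewrite adj_sym in uv.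
have := cdist_adj_le x uv; rewrite -(ler_nat R) -(ler_nat R (cdist x v)) -!natr1 => h1 h2.
by rewrite ler_norml; apply/andP; split; lra.
Qed.

Lemma height_edge x u v t : adj u v -> 0 <= t <= 1 ->
  height x (edge_pt u v t) =
  Num.min ((cdist x u)%:R + t) ((cdist x v)%:R + 1 - t).
Proof.
move=> uv /andP[t0 t1]; have := cdist_edge x uv; rewrite ler_norml => /andP[d1 d2].
have uv' := adj_neq uv.
have supp i : 0 < edge_pt u v t i -> i = u \/ i = v.
  have [->|iu] := eqVneq i u; first by left.
  have [->|iv] := eqVneq i v; first by right.
  by rewrite edge_pt_supp ?ltxx.
have [le_uv|lt_vu] := leP ((cdist x u)%:R + t) ((cdist x v)%:R + 1 - t).
  (* At [t = 1] the vertex [u] has left the support, but then the two candidates coincide because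
     the distances to the ends of an edge differ by at most 1. *)
  have [t1'|t1'] := ltP t 1.
    rewrite (@height_eq _ _ u) edge_ptl//; first lra.
      lra.
    by move=> w /supp[]->; rewrite ?edge_ptl ?edge_ptr//; lra.
  have -> : t = 1 by lra.
  by rewrite edge_pt1 height_vertex; lra.
have [t0'|t0'] := ltP 0 t.
  rewrite (@height_eq _ _ v) edge_ptr//.
  by move=> w /supp[]->; rewrite ?edge_ptl ?edge_ptr//; lra.
have -> : t = 0 by lra.
by rewrite edge_pt0 height_vertex; lra.
Qed.

Lemma height_lipschitz x u v s t : adj u v -> 0 <= s <= 1 -> 0 <= t <= 1 ->
  height x (edge_pt u v s) <= `|s - t| + height x (edge_pt u v t).
Proof.
move=> uv s01 t01; rewrite !height_edge// /Num.min /Order.min.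
have := ler_norm (s - t); have := ler_norm (t - s); rewrite (distrC t).
by case: ifP; case: ifP; lra.
Qed.

(** The height is 1-Lipschitz on each edge, hence along polylines. This is the source of all lower
    bounds on intrinsic distances. *)
Lemma polyline_height_le x A p q l : polyline A p q l ->
  height x p <= l + height x q /\ height x q <= l + height x p.
Proof.
elim=> [p' _|u v s t q' l' uv s01 t01 _ _ [ih1 ih2]]; first by rewrite add0r.
have := height_lipschitz x uv s01 t01; have := height_lipschitz x uv t01 s01.
by rewrite (distrC t); split; lra.
Qed.

Lemma polyline_ge0 (A : set (X -> R)) p q l : polyline A p q l -> 0 <= l.
Proof. by elim=> // *; rewrite addr_ge0. Qed.

Lemma polyline_trans (A : set (X -> R)) p q q' l l' :
  polyline A p q l -> polyline A q q' l' -> polyline A p q' (l + l').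
Proof.
elim=> [? _|u v s t q0 l0 uv s01 t01 Ac _ ih qq']; first by rewrite add0r.
by rewrite -addrA; apply: polyline_cons => //; apply: ih.
Qed.

Lemma polyline_segment (A : set (X -> R)) u v s t :
  adj u v -> 0 <= s <= 1 -> 0 <= t <= 1 ->
  (forall c, Num.min s t <= c <= Num.max s t -> A (edge_pt u v c)) ->
  polyline A (edge_pt u v s) (edge_pt u v t) `|s - t|.
Proof.
move=> uv s01 t01 Ac; rewrite -(addr0 (Num.norm _)); apply: polyline_cons => //.
by apply: polyline_nil; apply: Ac; rewrite ge_min le_max lexx !orbT.
Qed.

Lemma polyline_subset (A B : set (X -> R)) p q l :
  A `<=` B -> polyline A p q l -> polyline B p q l.
Proof.
move=> AB; elim=> [p' /AB Bp|u v s t q' l' uv s01 t01 Ac _ ih].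
  exact: polyline_nil.
by apply: polyline_cons => // c /Ac /AB.
Qed.

(* The ball of radius [h], once the height is known to be the distance. *)
Definition sublevel x (h : R) : set (X -> R) :=
  [set p | @realization R X p /\ height x p <= h].

Lemma polyline_to_vertex x h u : (cdist x u)%:R <= h ->
  polyline (sublevel x h) (vertex_pt R x) (vertex_pt R u) (cdist x u)%:R.
Proof.
move: {2}(cdist x u) (erefl (cdist x u)) => n; elim: n u => [|n ih] u un uh.
  rewrite -(cdist_eq0 un) cdistxx; apply: polyline_nil; split.
    exact: realization_vertex.
  by move: uh; rewrite height_vertex cdistxx un.
have [|v vu e] := @cdist_pred _ x u; first by rewrite un.
have vn : cdist x v = n by move: un; rewrite e => -[].
move: uh; rewrite un -natr1 -vn => uh.
apply: (@polyline_trans _ _ (vertex_pt R v)); first by apply: ih => //; lra.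
have -> : 1 = `|0 - 1| :> R by rewrite sub0r normrN normr1.
rewrite -(edge_pt0 R v u) -(edge_pt1 R v u).
apply: polyline_segment; rewrite ?lexx ?ler01// => c.
rewrite minEle maxEle ler01 => c01; split; first exact: realization_edge.
rewrite height_edge// e -natr1 ge_min; apply/orP; left.
by move/andP: c01; lra.
Qed.

(** A geodesic from [x] to [p] contains no point farther from [x] than [p], so it stays in the ball.
    Hence distances from the center are the same in the intrinsic metric of a ball and in the whole
    graph. *)
Lemma polyline_height x p : @realization R X p ->
  polyline (sublevel x (height x p)) (vertex_pt R x) p (height x p).
Proof.
case=> [[u ->]|[u [v [t [uv t01 ->]]]]].
  by rewrite height_vertex; apply: polyline_to_vertex.
(* A shortest way to a point of an edge enters through the end realizing the minimum; reversing the
   edge makes this end [u]. *)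
wlog le_uv : u v t uv t01 / (cdist x u)%:R + t <= (cdist x v)%:R + 1 - t.
  move=> wl; have [|lt_vu] := leP ((cdist x u)%:R + t) ((cdist x v)%:R + 1 - t).
    exact: wl.
  rewrite edge_ptC; apply: wl; first by rewrite adj_sym.
    by move/andP: t01 => [? ?]; apply/andP; split; lra.
  by lra.
have hE : height x (edge_pt u v t) = (cdist x u)%:R + t.
  by rewrite height_edge// min_l.
have /andP[t0 t1] := t01.
rewrite hE; apply: (@polyline_trans _ _ (vertex_pt R u)).
  apply: polyline_subset (polyline_to_vertex (lexx _)) => q [q1 q2].
  by split => //; apply: le_trans q2 _; rewrite lerDl.
rewrite -(edge_pt0 R u v) -[X in polyline _ _ _ X](ger0_norm t0) -normrN.
rewrite -(sub0r t).
apply: polyline_segment; rewrite ?lexx ?ler01// => c.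
rewrite min_l// max_r// => /andP[c0 ct].
have c01 : 0 <= c <= 1 by rewrite c0 (le_trans ct).
split; first exact: realization_edge.
by rewrite height_edge// ge_min lerD2l ct.
Qed.

Lemma le_intrinsic_dist (A : set (X -> R)) p q l :
  polyline A p q l -> intrinsic_dist A p q <= l.
Proof.
by move=> Al; apply: ge_inf => //; exists 0 => l' /polyline_ge0.
Qed.

Lemma intrinsic_dist_height A x p : polyline A (vertex_pt R x) p (height x p) ->
  intrinsic_dist A (vertex_pt R x) p = height x p.
Proof.
move=> Ap; apply/eqP; rewrite eq_le le_intrinsic_dist//=.
apply: lb_le_inf; first by exists (height x p).
by move=> l /(polyline_height_le x)[_]; rewrite height_vertex cdistxx addr0.
Qed.

Lemma gdist_height x p : @realization R X p ->
  gdist (vertex_pt R x) p = height x p.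
Proof.
move=> pX; apply: intrinsic_dist_height.
by apply: polyline_subset (polyline_height x pX) => q [].
Qed.

Lemma vdistE x y : vdist R x y = (cdist x y)%:R.
Proof.
by rewrite /vdist gdist_height ?height_vertex//; exact: realization_vertex.
Qed.

Lemma gballE x (r : R) : gball x r = sublevel x r.
Proof.
apply/seteqP; split => p [pX]; first by rewrite gdist_height//; split.
by move=> h; split=> //; rewrite gdist_height.
Qed.

Lemma intrinsic_dist_center x (r : R) p : gball x r p ->
  intrinsic_dist (gball x r) (vertex_pt R x) p = height x p.
Proof.
rewrite gballE => -[pX pr]; apply: intrinsic_dist_height.
apply: polyline_subset (polyline_height x pX) => q [qX qp].
by split=> //; apply: le_trans pr.
Qed.

End Height.

(** * Combinatorial isomorphisms of balls *)

(** A rooted isomorphism of the induced subgraphs on two balls. The maps are total but unconstrained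
    outside the balls, so the same pair serves for smaller balls, and carrying the inverse makes the
    notion symmetric. *)
Definition ball_isom (X Y : graph) n (x : X) (y : Y)
    (phi : X -> Y) (psi : Y -> X) : Prop :=
  [/\ phi x = y /\ psi y = x,
      forall u, (cdist x u <= n)%N -> (cdist y (phi u) <= n)%N /\ psi (phi u) = u,
      forall v, (cdist y v <= n)%N -> (cdist x (psi v) <= n)%N /\ phi (psi v) = v &
      forall u u', (cdist x u <= n)%N -> (cdist x u' <= n)%N ->
        adj (phi u) (phi u') = adj u u'].

Definition balls_iso (X Y : graph) n (x : X) (y : Y) : Prop :=
  exists phi psi, ball_isom n x y phi psi.

Lemma ball_isom_sym (X Y : graph) n (x : X) (y : Y) phi psi :
  ball_isom n x y phi psi -> ball_isom n y x psi phi.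
Proof.
move=> [[xy yx] phiP psiP adjP]; split=> // v v' yv yv'.
have [xv ev] := psiP _ yv; have [xv' ev'] := psiP _ yv'.
by rewrite -{2}ev -{2}ev' adjP.
Qed.

Lemma ball_isom_comp (X Y Z : graph) n (x : X) (y : Y) (z : Z) phi psi phi' psi' :
  ball_isom n x y phi psi -> ball_isom n y z phi' psi' ->
  ball_isom n x z (phi' \o phi) (psi \o psi').
Proof.
move=> [[xy yx] phiP psiP adjP] [[yz zy] phiP' psiP' adjP']; split=> /=.
- by rewrite xy zy.
- by move=> u /phiP[/[dup] yu /phiP'[? ->] ->].
- by move=> u /psiP'[/[dup] yu /psiP[? ->] ->].
- by move=> u u' xu xu'; rewrite adjP' ?adjP//; [case: (phiP _ xu)|case: (phiP _ xu')].
Qed.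

Lemma balls_iso_sym (X Y : graph) n (x : X) (y : Y) :
  balls_iso n x y -> balls_iso n y x.
Proof. by move=> [phi [psi /ball_isom_sym]]; exists psi, phi. Qed.

Lemma balls_iso_trans (X Y Z : graph) n (x : X) (y : Y) (z : Z) :
  balls_iso n x y -> balls_iso n y z -> balls_iso n x z.
Proof.
move=> [phi [psi xy]] [phi' [psi' yz]].
by exists (phi' \o phi), (psi \o psi'); apply: ball_isom_comp yz.
Qed.

Section BallIsom.
Variables (X Y : graph) (n : nat) (x : X) (y : Y) (phi : X -> Y) (psi : Y -> X).
Hypothesis iso : ball_isom n x y phi psi.

(** The hypothesis keeps a geodesic from [u] to [w] inside the ball at [x], where [phi] preserves
    adjacency. *)
Lemma ball_isom_dist_le u w : (cdist x u + cdist u w <= n)%N ->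
  (cdist (phi u) (phi w) <= cdist u w)%N.
Proof.
have [_ _ _ adjP] := iso.
move: {2}(cdist u w) (erefl (cdist u w)) => k; elim: k w => [|k ih] w uw n_ge.
  by rewrite (cdist_eq0 uw) !cdistxx.
have [|z zw e] := @cdist_pred _ u w; first by rewrite uw.
have uz : cdist u z = k by move: uw; rewrite e => -[].
have := cdist_triangle u x z; have := cdist_triangle u x w => xw xz.
apply: leq_trans (cdist_triangle (phi z) _ _) _.
rewrite e -addn1 leq_add ?ih//; first lia.
by rewrite cdist_adj// adjP//; lia.
Qed.

End BallIsom.

Lemma ball_isom_dist (X Y : graph) n (x : X) (y : Y) phi psi u :
  ball_isom n x y phi psi -> (cdist x u <= n)%N -> cdist y (phi u) = cdist x u.
Proof.
move=> iso xu; have [[xy yx] phiP _ _] := iso; have [yu e] := phiP _ xu.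
apply/eqP; rewrite eqn_leq -{1}xy (ball_isom_dist_le iso) ?cdistxx//=.
by rewrite -{1}yx -{1}e (ball_isom_dist_le (ball_isom_sym iso)) ?cdistxx.
Qed.

Lemma ball_isom_center (X Y : graph) n m (x : X) (y : Y) phi psi u :
  ball_isom n x y phi psi -> (cdist x u + m <= n)%N ->
  ball_isom m u (phi u) phi psi.
Proof.
move=> iso xu; have iso' := ball_isom_sym iso.
have [[xy yx] phiP psiP adjP] := iso.
have xu' : (cdist x u <= n)%N by lia.
have [yu e] := phiP _ xu'; have yuE := ball_isom_dist iso xu'.
split=> //.
- move=> w uw; have xw := cdist_triangle u x w.
  have [|_ ew] := phiP w; first lia.
  by split=> //; rewrite (leq_trans _ uw)// (ball_isom_dist_le iso)//; lia.
- move=> w uw; have yw := cdist_triangle (phi u) y w.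
  have [|_ ew] := psiP w; first lia.
  split=> //; rewrite -{1}e (leq_trans _ uw)// (ball_isom_dist_le iso')//; lia.
- move=> w w' uw uw'; have xw := cdist_triangle u x w.
  by have xw' := cdist_triangle u x w'; apply: adjP; lia.
Qed.

Lemma balls_iso_le (X Y : graph) m n (x : X) (y : Y) :
  (m <= n)%N -> balls_iso n x y -> balls_iso m x y.
Proof.
move=> mn [phi [psi iso]]; exists phi, psi; have [[xy _] _ _ _] := iso.
by rewrite -xy; apply: ball_isom_center iso _; rewrite cdistxx.
Qed.

Lemma natr_le (R : realType) m n : m%:R <= n%:R :> R -> (m <= n)%N.
Proof. by rewrite ler_nat. Qed.

(** * From combinatorial isomorphisms to isometries of metric balls *)

Section GballVertices.
Context (R : realType) (X : graph).

Lemma vertex_gball (x : X) n (r : R) u : r + 1 <= n%:R ->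
  gball x r (vertex_pt R u) -> (cdist x u <= n)%N.
Proof.
rewrite gballE => rn [_]; rewrite height_vertex => xu.
by apply: (natr_le (R := R)); lra.
Qed.

Lemma gball_vertex (x : X) n (r : R) u : n%:R + 1 <= r ->
  (cdist x u <= n)%N -> gball x r (vertex_pt R u).
Proof.
rewrite gballE -(ler_nat R) => nr xu; split; first exact: realization_vertex.
by rewrite height_vertex; lra.
Qed.

(** The unit of margin absorbs the ends of an edge that the metric ball contains only partially. *)
Lemma gball_edge (x : X) n (r : R) u v (c : R) : r + 1 <= n%:R ->
  adj u v -> 0 <= c <= 1 -> gball x r (edge_pt u v c) ->
  (cdist x u <= n)%N /\ (cdist x v <= n)%N.
Proof.
move=> rn uv c01; rewrite gballE => -[_]; rewrite height_edge//.
have := cdist_edge R x uv; rewrite ler_norml => /andP[d1 d2].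
have /andP[c0 c1] := c01.
by rewrite ge_min => /orP[] ?; split; apply: (natr_le (R := R)); lra.
Qed.

Lemma edge_gball (x : X) n (r : R) u v (c : R) : n%:R + 1 <= r ->
  adj u v -> 0 <= c <= 1 -> (cdist x u <= n)%N -> gball x r (edge_pt u v c).
Proof.
move=> nr uv c01; rewrite gballE -(ler_nat R) => xu.
split; first exact: realization_edge.
by rewrite height_edge// ge_min; apply/orP; left; move/andP: c01; lra.
Qed.

End GballVertices.

Section PushForward.
Variables (R : realType) (X Y : graph) (n : nat) (x : X) (y : Y).
Variables (phi : X -> Y) (psi : Y -> X).
Hypothesis iso : ball_isom n x y phi psi.

(** Barycentric coordinates are pulled back along the inverse [psi]; since [psi] is unconstrained
    outside the ball, the weight there is set to 0. *)
Definition push (p : X -> R) : Y -> R :=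
  fun v => if (cdist y v <= n)%N then p (psi v) else 0.

Lemma push_vertex u : (cdist x u <= n)%N ->
  push (vertex_pt R u) = vertex_pt R (phi u).
Proof.
have [_ phiP psiP _] := iso => xu; have [yu e] := phiP _ xu.
apply/funext => v; rewrite /push; case: ifPn => yv.
  have [xv ev] := psiP _ yv; rewrite !vertex_ptE; congr (_%:R).
  by congr nat_of_bool; apply/eqP/eqP => [<-|->].
by rewrite vertex_ptE; case: eqP yv => // ->; rewrite yu.
Qed.

Lemma push_edge u v (t : R) : (cdist x u <= n)%N -> (cdist x v <= n)%N ->
  push (edge_pt u v t) = edge_pt (phi u) (phi v) t.
Proof.
move=> xu xv; apply/funext => w.
rewrite /edge_pt -!push_vertex// /push; case: ifP => //.
by rewrite !mulr0 addr0.
Qed.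

Variable r : R.
Hypothesis r_lt : r + 1 <= n%:R :> R.

Lemma push_gball_edge u v (c : R) : adj u v -> 0 <= c <= 1 ->
  gball x r (edge_pt u v c) -> gball y r (edge_pt (phi u) (phi v) c).
Proof.
move=> uv c01 r_uv; have [xu xv] := gball_edge r_lt uv c01 r_uv.
have [_ _ _ adjP] := iso; have uv' : adj (phi u) (phi v) by rewrite adjP.
move: r_uv; rewrite !gballE => -[_]; rewrite height_edge// => ru.
split; first exact: realization_edge.
by rewrite height_edge// !(ball_isom_dist iso).
Qed.

Lemma push_gball p : gball x r p -> gball y r (push p).
Proof.
move=> xp; have [[[u pE]|[u [v [t [uv t01 pE]]]]] _] := xp; last first.
  have [xu xv] : (cdist x u <= n)%N /\ (cdist x v <= n)%N.
    by apply: (gball_edge r_lt uv t01); rewrite -pE.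
  by rewrite pE push_edge//; apply: push_gball_edge; rewrite -?pE.
have xu : (cdist x u <= n)%N by apply: (vertex_gball r_lt); rewrite -pE.
move: xp; rewrite pE gballE => -[_]; rewrite height_vertex => xu'.
rewrite push_vertex// gballE; split; first exact: realization_vertex.
by rewrite height_vertex (ball_isom_dist iso).
Qed.

Lemma push_polyline p q l : polyline (gball x r) p q l ->
  polyline (gball y r) (push p) (push q) l.
Proof.
elim=> [{}p xp|u v s t {}q {}l uv s01 t01 Ac _ ih].
  by apply: polyline_nil; apply: push_gball.
have sI : Num.min s t <= s <= Num.max s t by rewrite ge_min le_max lexx.
have [xu xv] := gball_edge r_lt uv s01 (Ac _ sI).
have [_ _ _ adjP] := iso; have uv' : adj (phi u) (phi v) by rewrite adjP.
rewrite push_edge//; apply: polyline_cons => //; last by rewrite -push_edge.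
move=> c cI; apply: push_gball_edge (Ac _ cI) => //.
move/andP: cI s01 t01 => []; rewrite ge_min le_max => + + /andP[? ?] /andP[? ?].
by move=> /orP[?|?] /orP[?|?]; apply/andP; split; lra.
Qed.

End PushForward.

Lemma push_gballK (R : realType) (X Y : graph) n (x : X) (y : Y) phi psi (r : R) p :
  ball_isom n x y phi psi -> r + 1 <= n%:R -> gball x r p ->
  push n x phi (push n y psi p) = p.
Proof.
move=> iso rn xp; have iso' := ball_isom_sym iso; have [_ phiP _ adjP] := iso.
have [[[u pE]|[u [v [t [uv t01 pE]]]]] _] := xp; last first.
  have [xu xv] : (cdist x u <= n)%N /\ (cdist x v <= n)%N.
    by apply: (gball_edge rn uv t01); rewrite -pE.
  have [yu eu] := phiP _ xu; have [yv ev] := phiP _ xv.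
  by rewrite pE (push_edge iso)// (push_edge iso')// eu ev.
have xu : (cdist x u <= n)%N by apply: (vertex_gball rn); rewrite -pE.
have [yu eu] := phiP _ xu.
by rewrite pE (push_vertex _ iso)// (push_vertex _ iso')// eu.
Qed.

(** Intrinsic distances are infima of lengths of polylines in the ball, and [push] carries polylines
    to polylines of the same length in both directions. *)
Lemma balls_iso_isometric (R : realType) (X Y : graph) n (x : X) (y : Y) (r : R) :
  0 <= r -> r + 1 <= n%:R -> balls_iso n x y -> isometric_balls x y r.
Proof.
move=> r0 rn [phi [psi iso]]; have iso' := ball_isom_sym iso.
exists (push n y psi); split.
- split=> [p xp|p q /set_mem xp /set_mem xq pq|q yq].
  + exact: (push_gball iso).
  + by rewrite -(push_gballK iso rn xp) pq (push_gballK iso rn xq).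
  + exists (push n x phi q); first exact: (push_gball iso').
    exact: (push_gballK iso' rn).
- have [[xy _] _ _ _] := iso.
  by rewrite (push_vertex _ iso) ?cdistxx // xy.
- move=> p q xp xq; congr inf; apply/seteqP; split=> l /=.
    move/(push_polyline iso' rn).
    by rewrite (push_gballK iso rn xp) (push_gballK iso rn xq).
  exact: (push_polyline iso).
Qed.

(** An isometry of balls is not assumed to map vertices to vertices; it does so because it preserves
    the distance to the center, which is never an integer in the interior of an edge. *)
Lemma height_nat (R : realType) (Y : graph) (y : Y) (p : Y -> R) m :
  realization p -> height y p = m%:R ->
  exists2 v, p = vertex_pt R v & cdist y v = m.
Proof.
case=> [[v ->]|[u [v [t [uv t01 ->]]]]].
  by rewrite height_vertex => /eqP; rewrite eqr_nat => /eqP; exists v.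
wlog le_uv : u v t uv t01 / (cdist y u)%:R + t <= (cdist y v)%:R + 1 - t.
  move=> wl; have [|lt_vu] := leP ((cdist y u)%:R + t) ((cdist y v)%:R + 1 - t).
    exact: wl.
  rewrite edge_ptC; apply: wl; first by rewrite adj_sym.
    by move/andP: t01 => [? ?]; apply/andP; split; lra.
  by lra.
rewrite height_edge// min_l// => e; have /andP[t0 t1] := t01.
have um : (cdist y u <= m)%N by rewrite -(ler_nat R) -e lerDl.
have mu : (m <= (cdist y u).+1)%N by rewrite -(ler_nat R) -e -natr1 lerD2l.
have [um'|um'] := eqVneq (cdist y u) m.
  exists u => //; move: e; rewrite um' => /eqP; rewrite -subr_eq0 addrAC subrr add0r.
  by move=> /eqP->; rewrite edge_pt0.
have mE : m = (cdist y u).+1 by lia.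
have tE : t = 1 by move: e; rewrite mE -natr1 => /addrI.
exists v; first by rewrite tE edge_pt1.
move: le_uv; rewrite tE addrK mE natr1 ler_nat => uv'.
by have := cdist_adj_le y uv; lia.
Qed.

(** * From isometries of metric balls to combinatorial isomorphisms *)

Section IsometryVertices.
Variables (R : realType) (X Y : graph) (n : nat) (x : X) (y : Y) (r : R).
Variable f : (X -> R) -> (Y -> R).
Hypothesis n_lt : n%:R + 1 <= r.
Hypothesis f_fun : forall p, gball x r p -> gball y r (f p).
Hypothesis f_center : f (vertex_pt R x) = vertex_pt R y.
Hypothesis f_dist : forall p q, gball x r p -> gball x r q ->
  intrinsic_dist (gball y r) (f p) (f q) = intrinsic_dist (gball x r) p q.

Lemma isometry_vertex u : (cdist x u <= n)%N ->
  exists2 v, f (vertex_pt R u) = vertex_pt R v & cdist y v = cdist x u.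
Proof.
move=> xu; have ru := gball_vertex n_lt xu; have [fX _] := f_fun ru.
apply: height_nat => //; rewrite -(height_vertex R x u).
rewrite -(intrinsic_dist_center ru) -(intrinsic_dist_center (f_fun ru)) -f_center.
by rewrite f_dist//; apply: (gball_vertex n_lt); rewrite cdistxx.
Qed.

Definition vertex_map u : Y := xget y [set v | f (vertex_pt R u) = vertex_pt R v].

Lemma vertex_mapE u : (cdist x u <= n)%N ->
  f (vertex_pt R u) = vertex_pt R (vertex_map u).
Proof. by move=> /isometry_vertex[v fv _]; rewrite /vertex_map; apply: (xgetPex y (P := [set w | f (vertex_pt R u) = vertex_pt R w])); exists v. Qed.

Lemma vertex_map_dist u : (cdist x u <= n)%N -> cdist y (vertex_map u) = cdist x u.
Proof.
move=> xu; have [v fv <-] := isometry_vertex xu; congr cdist.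
by apply: (@vertex_pt_inj R); rewrite -vertex_mapE.
Qed.

(** The images are at intrinsic distance 1, and the graph distance cannot exceed the intrinsic one.
    That the images differ is assumed here, since injectivity comes later from the inverse
    isometry. *)
Lemma vertex_map_adj u v : (cdist x u <= n)%N -> (cdist x v <= n)%N -> adj u v ->
  vertex_map u != vertex_map v -> adj (vertex_map u) (vertex_map v).
Proof.
move=> xu xv uv uv'.
suff : (cdist (vertex_map u) (vertex_map v) <= 1)%N.
  by case E: cdist (@cdist_eq0 _ (vertex_map u) (vertex_map v)) => [|[|]] // eq0 _;
    [rewrite eq0 ?eqxx in uv'|rewrite adj_cdist E].
have seg : polyline (gball x r) (vertex_pt R u) (vertex_pt R v) 1.
  have -> : 1 = `|0 - 1| :> R by rewrite sub0r normrN normr1.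
  rewrite -(edge_pt0 R u v) -(edge_pt1 R u v).
  apply: polyline_segment; rewrite ?lexx ?ler01// => c.
  by rewrite min_l ?max_r// => c01; apply: edge_gball n_lt _ _ _.
have e1 : intrinsic_dist (gball x r) (vertex_pt R u) (vertex_pt R v) = 1.
  apply/eqP; rewrite eq_le le_intrinsic_dist//=.
  apply: lb_le_inf; first by exists 1.
  move=> l /(polyline_height_le u)[_]; rewrite !height_vertex cdistxx addr0.
  by move: uv; rewrite adj_cdist => /eqP->.
have := f_dist (gball_vertex n_lt xu) (gball_vertex n_lt xv); rewrite e1 !vertex_mapE// => e2.
set D := (X in inf X = 1) in e2.
have lbD l : D l -> (cdist (vertex_map u) (vertex_map v))%:R <= l.
  move=> /(polyline_height_le (vertex_map u))[_].
  by rewrite !height_vertex cdistxx addr0.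
(* The infimum of the empty set is 0 by convention, so the value 1 shows that some polyline joins
   the images. *)
have [D0|/set0P D0] := eqVneq D set0.
  by move: e2; rewrite /intrinsic_dist -/D D0 inf0 => /eqP; rewrite eq_sym oner_eq0.
apply: (natr_le (R := R)); have -> : 1%:R = inf D :> R := esym e2.
by apply: lb_le_inf => // l /lbD.
Qed.

End IsometryVertices.

(** The inverse of the isometry satisfies the same hypotheses, so both induce vertex maps, and these
    are mutually inverse because [vertex_pt] is injective. *)
Lemma isometric_balls_iso (R : realType) (X Y : graph) n (x : X) (y : Y) (r : R) :
  n%:R + 1 <= r -> isometric_balls x y r -> balls_iso n x y.
Proof.
move=> nr [f [[f_fun f_inj f_surj] f_center f_dist]].
have [g gP] : exists g, forall q, gball y r q -> gball x r (g q) /\ f (g q) = q.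
  have : forall q, exists p, gball y r q -> gball x r p /\ f p = q.
    move=> q; have [yq|] := pselect (gball y r q); last by exists (fun=> 0).
    by have [p] := f_surj q yq; exists p.
  by move=> /choice[g gP]; exists g.
have fK p : gball x r p -> g (f p) = p.
  move=> xp; have [xg e] := gP _ (f_fun _ xp).
  by apply: f_inj e; apply/mem_set.
have r0 : 0 <= r by have := ler0n R n; lra.
have x_in : gball x r (vertex_pt R x) by apply: (gball_vertex nr); rewrite cdistxx.
have y_in : gball y r (vertex_pt R y) by apply: (gball_vertex nr); rewrite cdistxx.
have g_center : g (vertex_pt R y) = vertex_pt R x by rewrite -f_center fK.
have g_fun q : gball y r q -> gball x r (g q) by case/gP.
have g_dist p q : gball y r p -> gball y r q ->
    intrinsic_dist (gball x r) (g p) (g q) = intrinsic_dist (gball y r) p q.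
  move=> yp yq; have [xp ep] := gP _ yp; have [xq eq] := gP _ yq.
  by rewrite -{2}ep -{2}eq f_dist.
pose phi := vertex_map y f; pose psi := vertex_map x g.
have phiE u : (cdist x u <= n)%N -> f (vertex_pt R u) = vertex_pt R (phi u).
  exact: (vertex_mapE nr f_fun f_center f_dist).
have psiE u : (cdist y u <= n)%N -> g (vertex_pt R u) = vertex_pt R (psi u).
  exact: (vertex_mapE nr g_fun g_center g_dist).
have phiD u : (cdist x u <= n)%N -> (cdist y (phi u) <= n)%N.
  by move=> xu; rewrite (vertex_map_dist nr f_fun f_center f_dist).
have psiD u : (cdist y u <= n)%N -> (cdist x (psi u) <= n)%N.
  by move=> yu; rewrite (vertex_map_dist nr g_fun g_center g_dist).
have phiK u : (cdist x u <= n)%N -> psi (phi u) = u.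
  move=> xu; apply: (@vertex_pt_inj R); rewrite -psiE ?phiD// -phiE//.
  by rewrite fK//; apply: (gball_vertex nr).
have psiK u : (cdist y u <= n)%N -> phi (psi u) = u.
  move=> yu; apply: (@vertex_pt_inj R); rewrite -phiE ?psiD// -psiE//.
  by have [] := gP (vertex_pt R u) (gball_vertex nr yu).
have cx : (cdist x x <= n)%N by rewrite cdistxx.
have cy : (cdist y y <= n)%N by rewrite cdistxx.
exists phi, psi; split.
- by split; apply: (@vertex_pt_inj R); rewrite -?phiE -?psiE.
- by move=> u xu; split; [exact: phiD|exact: phiK].
- by move=> v yv; split; [exact: psiD|exact: psiK].
move=> u u' xu xu'; apply/idP/idP => uu'.
  rewrite -(phiK u)// -(phiK u')//.
  apply: (vertex_map_adj nr g_fun g_center g_dist); rewrite ?phiD//.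
  rewrite -/psi !phiK//; apply: contraTneq uu' => ->; by rewrite adj_irr.
apply: (vertex_map_adj nr f_fun f_center f_dist) => //.
apply: contraTneq uu' => e.
by rewrite -(phiK u)// -(phiK u')// /phi e adj_irr.
Qed.

(** * Ultraproducts of pointed graphs *)

Lemma ultra_or (T : Type) (U : set_system T) (UU : UltraFilter U) (A B : T -> Prop) :
  (\forall m \near U, A m \/ B m) ->
  (\forall m \near U, A m) \/ (\forall m \near U, B m).
Proof.
move=> AB; have [|nA] := in_ultra_setVsetC A UU; [by left|right].
by apply: filterS2 AB nA => m [].
Qed.

(** The number [n] of alternatives does not depend on [m]; this is what allows the ultrafilter to
    single one out. *)
Lemma ultra_exists (T : Type) (U : set_system T) (UU : UltraFilter U) n
    (A : nat -> T -> Prop) :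
  (\forall m \near U, exists2 i, (i < n)%N & A i m) ->
  exists2 i, (i < n)%N & \forall m \near U, A i m.
Proof.
elim: n => [|n ih] UA; first by have [m []] := filter_ex UA.
have : \forall m \near U, (exists2 i, (i < n)%N & A i m) \/ A n m.
  apply: filterS UA => m [i]; rewrite ltnS leq_eqVlt => /orP[/eqP->|]; first by right.
  by left; exists i.
move=> /ultra_or[/ih[i lt_in UAi]|UAn]; last by exists n.
by exists i => //; apply: ltnW.
Qed.

Lemma near_all_seq (T : Type) (I : eqType) (U : set_system T) (FU : Filter U)
    (s : seq I) (P : I -> T -> Prop) :
  (forall i, i \in s -> \forall m \near U, P i m) ->
  \forall m \near U, forall i, i \in s -> P i m.
Proof.
elim: s => [|i s ih] sP; first exact: nearW.
apply: filterS2 (sP i (mem_head _ _)) (ih _) => [m Pi Ps j|j js].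
  by rewrite in_cons => /orP[/eqP->|/Ps].
by apply: sP; rewrite in_cons js orbT.
Qed.

Lemma exists_ultrafilter : exists2 U : set_system nat, UltraFilter U &
  forall A, (\forall m \near \oo, A m) -> U A.
Proof. by have [U [UU sub]] := ultraFilterLemma (eventually_filter); exists U. Qed.

Definition degree_le (X : graph) D (x : X) : Prop :=
  exists2 s : seq X, (size s <= D)%N & forall y, adj x y -> y \in s.

Lemma finite_ball (X : graph) (x : X) n : finite_set [set u | (cdist x u <= n)%N].
Proof.
elim: n => [|n ih].
  apply: (sub_finite_set _ (finite_set1 x)) => u /=.
  by rewrite leqn0 => /eqP /cdist_eq0.
suff : finite_set ([set u | (cdist x u <= n)%N] `|`
    \bigcup_(v in [set u | (cdist x u <= n)%N]) [set w | adj v w]).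
  apply: sub_finite_set => u /=; rewrite leq_eqVlt => /orP[/eqP xu|]; last by left.
  right; have [|v vu e] := @cdist_pred _ x u; first by rewrite xu.
  by exists v => //=; rewrite -ltnS -e xu.
rewrite finite_setU; split => //.
by apply: bigcup_finite => // v _; exact: adj_lfin.
Qed.

Section Ultraproduct.
Local Open Scope quotient_scope.
Variables (W : nat -> graph) (base : forall m, W m).
Variables (U : set_system nat) (UU : UltraFilter U).

(** Bounded distance to the base points selects one connected component of the full ultraproduct. *)
Record bounded_seq := BoundedSeq {
  bseq :> forall m, W m;
  bseqP : exists C, forall m, (cdist (base m) (bseq m) <= C)%N }.

HB.instance Definition _ := gen_eqMixin bounded_seq.
HB.instance Definition _ := gen_choiceMixin bounded_seq.

Definition ae_eq (s t : bounded_seq) : bool := `[< \forall m \near U, s m = t m >].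

Lemma ae_eq_equiv : equiv_class_of ae_eq.
Proof.
split=> [s|s t|t s u].
- by apply/asboolP; apply: nearW.
- by apply/asboolP/asboolP; apply: filterS.
- move=> /asboolP st /asboolP tu; apply/asboolP.
  by apply: filterS2 st tu => m ->.
Qed.

Canonical ae_eq_equiv_rel := EquivRelPack ae_eq_equiv.

Definition ultra_vertex := {eq_quot ae_eq_equiv_rel}.
HB.instance Definition _ := Choice.on ultra_vertex.
HB.instance Definition _ := EqQuotient.on ultra_vertex.

Definition rep (z : ultra_vertex) : bounded_seq := repr z.
Definition ultra_class (s : bounded_seq) : ultra_vertex := \pi_ultra_vertex s.

Lemma rep_class s : \forall m \near U, rep (ultra_class s) m = s m.
Proof.
have : ultra_class (rep (ultra_class s)) = ultra_class s by rewrite /ultra_class /rep reprK.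
by move=> /eqquotP /asboolP.
Qed.

Lemma rep_inj a b : (\forall m \near U, rep a m = rep b m) -> a = b.
Proof.
move=> ab; rewrite -[a]reprK -[b]reprK.
by apply/eqquotP/asboolP.
Qed.

Lemma rep_neq a b : a <> b -> \forall m \near U, rep a m <> rep b m.
Proof.
move=> ab; have [/rep_inj//|] := in_ultra_setVsetC [set m | rep a m = rep b m] UU.
by [].
Qed.

Definition ultra_adj (a b : ultra_vertex) : bool :=
  `[< \forall m \near U, adj (rep a m) (rep b m) >].

Lemma ultra_adj_sym : symmetric ultra_adj.
Proof.
by move=> a b; apply/asboolP/asboolP; apply: filterS => m; rewrite adj_sym.
Qed.

Lemma ultra_adj_irr : irreflexive ultra_adj.
Proof.
move=> a; apply/asboolP => aa; have [m] := filter_ex aa.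
by rewrite adj_irr.
Qed.

Lemma ultra_vertex_of a C (w : forall m, W m) :
  (forall m, (cdist (rep a m) (w m) <= C)%N) ->
  exists z, \forall m \near U, rep z m = w m.
Proof.
move=> aw; have [Ca aC] := bseqP (rep a).
have wb : exists C, forall m, (cdist (base m) (w m) <= C)%N.
  exists (Ca + C)%N => m; apply: leq_trans (cdist_triangle (rep a m) _ _) _.
  exact: leq_add.
by exists (ultra_class (BoundedSeq wb)); apply: rep_class.
Qed.

(** An instance of Los's theorem, for an existential quantifier restricted to a ball: where no
    witness exists the value is [rep a m], so the chosen sequence stays bounded. *)
Lemma ultra_vertex_choice a C (P : forall m, W m -> Prop) :
  (\forall m \near U, exists2 w, (cdist (rep a m) w <= C)%N & P m w) ->
  exists z, \forall m \near U, P m (rep z m) /\ (cdist (rep a m) (rep z m) <= C)%N.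
Proof.
move=> UP.
pose w m := xget (rep a m) [set w | (cdist (rep a m) w <= C)%N /\ P m w].
have [|z Uz] := @ultra_vertex_of a C w; last first.
  exists z; apply: filterS2 UP Uz => m [v v1 v2] ->.
  by rewrite /w; case: xgetP => [u _ []//|/(_ v)[]].
by move=> m; rewrite /w; case: xgetP => [u _ []//|]; rewrite cdistxx.
Qed.

(** At each index a first step towards [b] is chosen, possibly staying put; the ultrafilter decides
    between staying and moving, and the induction continues from there. *)
Lemma ultra_path d a b : (\forall m \near U, (cdist (rep a m) (rep b m) <= d)%N) ->
  exists2 p, path ultra_adj a p & last a p = b /\ (size p <= d)%N.
Proof.
elim: d a => [|d ih] a ab.
  exists [::] => //=; split=> //; apply: rep_inj; apply: filterS ab => m.
  by rewrite leqn0 => /eqP /cdist_eq0.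
have [z Uz] : exists z, \forall m \near U, ((rep z m = rep a m \/
     adj (rep a m) (rep z m)) /\ (cdist (rep z m) (rep b m) <= d)%N) /\
     (cdist (rep a m) (rep z m) <= 1)%N.
  apply: (@ultra_vertex_choice a 1 (fun m w => (w = rep a m \/ adj (rep a m) w) /\
     (cdist w (rep b m) <= d)%N)).
  apply: filterS ab => m /cdist_step[w w1 w2]; exists w => //.
  by case: w1 => [->|/cdist_adj//]; rewrite cdistxx.
have [|p zp [pl ps]] := ih z; first by apply: filterS Uz => m [[]].
have : \forall m \near U, rep z m = rep a m \/ adj (rep a m) (rep z m).
  by apply: filterS Uz => m [[]].
move=> /ultra_or[/rep_inj <-|az]; first by exists p => //; split => //; exact: leqW.
by exists (z :: p); rewrite /= ?zp ?andbT//; apply/asboolP.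
Qed.

Lemma ultra_adj_conn a b : exists2 p, path ultra_adj a p & last a p = b.
Proof.
have [Ca aC] := bseqP (rep a); have [Cb bC] := bseqP (rep b).
have [|p ap [pl _]] := @ultra_path (Ca + Cb) a b; last by exists p.
apply: nearW => m; apply: leq_trans (cdist_triangle (base m) _ _) _.
by rewrite leq_add// cdist_sym.
Qed.

Lemma ultra_base_bounded : exists C, forall m, (cdist (base m) (base m) <= C)%N.
Proof. by exists 0%N => m; rewrite cdistxx. Qed.

Definition ultra_base : ultra_vertex := ultra_class (BoundedSeq ultra_base_bounded).

Lemma rep_base : \forall m \near U, rep ultra_base m = base m.
Proof. exact: (rep_class (BoundedSeq ultra_base_bounded)). Qed.

Variable D : nat.
Hypothesis W_degree : forall C, \forall m \near U, forall w : W m,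
  (cdist (base m) w <= C)%N -> degree_le D w.

(** Almost everywhere the neighbors of [rep a m] are numbered below [D]. A neighbor of [a] selects a
    number at almost every index, and the ultrafilter makes this number constant. *)
Lemma ultra_adj_lfin a : finite_set [set b | ultra_adj a b].
Proof.
have [Ca aC] := bseqP (rep a).
have nb m : exists s : seq (W m), degree_le D (rep a m) ->
    (size s <= D)%N /\ forall y, adj (rep a m) y -> y \in s.
  have [[s s1 s2]|] := pselect (degree_le D (rep a m)); first by exists s.
  by exists [::].
pose s m := projT1 (cid (nb m)).
have sP m : degree_le D (rep a m) ->
    (size (s m) <= D)%N /\ forall y, adj (rep a m) y -> y \in s m.
  exact: projT2 (cid (nb m)).
(* Entries that are not neighbors are replaced by [rep a m], which keeps each numbered sequence
   within distance 1 of [rep a]. *)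
pose w i m := let v := nth (rep a m) (s m) i in
   if adj (rep a m) v then v else rep a m.
have wE i : exists z, \forall m \near U, rep z m = w i m.
  apply: (@ultra_vertex_of a 1) => m; rewrite /w; case: ifP => [/cdist_adj//|].
  by rewrite cdistxx.
have [e eP] := choice wE.
apply: (sub_finite_set _ (finite_image e (finite_II D))) => b /asboolP ab.
have Ud : \forall m \near U, degree_le D (rep a m).
  by apply: filterS (W_degree Ca) => m; apply.
have : \forall m \near U, exists2 i, (i < D)%N & rep b m = w i m.
  apply: filterS2 Ud ab => m /sP[sD sA] abm.
  exists (index (rep b m) (s m)).
    by apply: leq_trans sD; rewrite index_mem; apply: sA.
  by rewrite /w nth_index ?abm//; apply: sA.
move=> /ultra_exists[i iD Ubi]; exists i => //; apply: rep_inj.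
by apply: filterS2 (eP i) Ubi => m /= -> ->.
Qed.

Definition ultraproduct : graph :=
  Graph ultra_adj_sym ultra_adj_irr ultra_adj_lfin ultra_adj_conn
    (ex_intro _ ultra_base I).

Lemma ultra_cdist_le n (a b : ultraproduct) :
  (cdist a b <= n)%N <-> \forall m \near U, (cdist (rep a m) (rep b m) <= n)%N.
Proof.
split=> [|/ultra_path[p ap [<- pn]]]; last by apply: leq_trans pn; apply: path_cdist.
elim: n a => [|n ih] a.
  rewrite leqn0 => /eqP /cdist_eq0->; apply: nearW => m.
  by rewrite cdistxx.
move=> /cdist_step[z az /ih zb]; case: az => [<-|/asboolP az].
  by apply: filterS zb => m /leqW.
apply: filterS2 az zb => m /cdist_adj az zb.
by apply: leq_trans (cdist_triangle (rep z m) _ _) _; rewrite -add1n leq_add.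
Qed.

(* Unless an ultrafilter-large set of the balls [B(rep z m, n)] is covered by
   the finite ball of the ultraproduct, some sequence of uncovered points
   would be one more vertex of that ball. *)
Lemma ultra_balls_iso n (z : ultraproduct) :
  \forall m \near U, balls_iso n z (rep z m).
Proof.
have /finite_seqP[B BE] := finite_ball z n.
have zB u : (cdist z u <= n)%N -> u \in B by move=> zu; have : [set` B] u by rewrite -BE.
have Bz u : u \in B -> (cdist z u <= n)%N.
  by move=> uB; have : [set u | (cdist z u <= n)%N] u by rewrite BE.
have E1 : \forall m \near U, forall u, u \in B -> (cdist (rep z m) (rep u m) <= n)%N.
  by apply: near_all_seq => u /Bz /ultra_cdist_le.
have E2 : \forall m \near U, forall u, u \in B -> forall v, v \in B ->
    rep u m = rep v m -> u = v.
  apply: near_all_seq => u _; apply: near_all_seq => v _.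
  have [->|uv] := pselect (u = v); first exact: nearW.
  by apply: filterS (rep_neq uv) => m.
have E3 : \forall m \near U, forall u, u \in B -> forall v, v \in B ->
    adj (rep u m) (rep v m) = adj u v.
  apply: near_all_seq => u _; apply: near_all_seq => v _.
  case uv: (adj u v); first by move/asboolP: uv.
  have [UA|] := in_ultra_setVsetC [set m | adj (rep u m) (rep v m)] UU.
    by move/asboolP: uv.
  by apply: filterS => m /negP /negbTE.
have E4 : \forall m \near U, forall w, (cdist (rep z m) w <= n)%N ->
    exists2 u, u \in B & rep u m = w.
  set P : nat -> Prop := fun m => forall w, _.
  have [//|nP] := in_ultra_setVsetC (P : set nat) UU.
  have [|v Uv] := @ultra_vertex_choice z n (fun m w => forall u, u \in B -> rep u m <> w).
    apply: filterS nP => m /existsNP[w /not_implyP[zw Bw]]; exists w => // u uB uw.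
    by apply: Bw; exists u.
  have vB : v \in B by apply/zB/ultra_cdist_le; apply: filterS Uv => m [].
  by have [m [/(_ v vB)]] := filter_ex Uv.
near=> m; have e1 : forall u, u \in B -> (cdist (rep z m) (rep u m) <= n)%N by near: m.
have e2 : forall u, u \in B -> forall v, v \in B -> rep u m = rep v m -> u = v by near: m.
have e3 : forall u, u \in B -> forall v, v \in B -> adj (rep u m) (rep v m) = adj u v.
  by near: m.
have e4 : forall w, (cdist (rep z m) w <= n)%N -> exists2 u, u \in B & rep u m = w.
  by near: m.
pose psi w := xget z [set u | u \in B /\ rep u m = w].
have psiP w : (cdist (rep z m) w <= n)%N -> psi w \in B /\ rep (psi w) m = w.
  by move=> /e4[u uB uw]; rewrite /psi; case: xgetP => [v _ //|/(_ u)[]].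
have psiK u : u \in B -> psi (rep u m) = u.
  by move=> uB; have [pB] := psiP _ (e1 u uB); apply: e2.
exists (fun u => rep u m), psi; split.
- by split=> //; apply: psiK; apply: zB; rewrite cdistxx.
- by move=> u /zB uB; rewrite psiK// e1.
- by move=> w /psiP[wB ew]; split=> //; apply: Bz.
- by move=> u v /zB uB /zB vB; rewrite e3.
Unshelve. all: by end_near. Qed.

End Ultraproduct.

(** * Coverings that are injective on balls *)

Section BallSize.
Context (X : graph).
Implicit Types (x y : X) (n : nat).

Definition ball_seq x n : seq X := fset_set [set u | (cdist x u <= n)%N].

Lemma mem_ball_seq x n u : (u \in ball_seq x n) = (cdist x u <= n)%N.
Proof.
rewrite /ball_seq in_fset_set; last exact: finite_ball.
by apply/idP/idP => [/set_mem//|h]; apply/mem_set.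
Qed.

Lemma ball_seq_uniq x n : uniq (ball_seq x n).
Proof. exact: fset_uniq. Qed.

End BallSize.

Lemma balls_iso_size_le (X Y : graph) n (x : X) (y : Y) : balls_iso n x y ->
  (size (ball_seq x n) <= size (ball_seq y n))%N.
Proof.
move=> [phi [psi [_ phiP _ _]]]; rewrite -(size_map phi); apply: uniq_leq_size.
  rewrite map_inj_in_uniq ?ball_seq_uniq// => u v.
  by rewrite !mem_ball_seq => /phiP[_ {2}<-] /phiP[_ {2}<-] ->.
by move=> _ /mapP[u + ->]; rewrite !mem_ball_seq => /phiP[].
Qed.

Lemma uniq_map_inj (T T' : eqType) (f : T -> T') (s : seq T) :
  uniq (map f s) -> {in s &, injective f}.
Proof.
elim: s => [//|a s ih] /= /andP[fa /ih inj] u v.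
rewrite !in_cons => /orP[/eqP->|us] /orP[/eqP->|vs] // e.
- by case/negP: fa; rewrite e map_f.
- by case/negP: fa; rewrite -e map_f.
- exact: inj.
Qed.

(** The trace of cocompactness on balls: a vertex that looks like [x] at every scale recurs within
    [C] of any vertex. *)
Definition cobounded C (X : graph) : Prop := forall x x' : X,
  exists2 y : X, (cdist x' y <= C)%N & forall n, balls_iso n x y.

Lemma is_isometry_balls_iso (R : realType) (X : graph) (g : X -> X) n (x : X) :
  is_isometry R g -> balls_iso n x (g x).
Proof.
move=> [[h gK hK] gd].
have gE u v : cdist (g u) (g v) = cdist u v.
  by apply/eqP; rewrite -(eqr_nat R) -!vdistE gd.
exists g, h; split => [//|u|v|u v _ _].
- by rewrite gE gK.
- by rewrite -{1}(hK v) gE hK.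
- by rewrite !adj_cdist gE.
Qed.

Lemma cocompact_cobounded (R : realType) (X : graph) :
  cocompact R X -> exists C, cobounded C X.
Proof.
move=> [F [/finite_seqP[s ->] FP]]; have [z0 _] := vertex_inh X.
(* This constant bounds the distance between two orbit representatives, through [z0]. The isometry
   taking [z'] to [x'] then moves the representative of [x] close to [x']. *)
exists ((\max_(z <- s) cdist z0 z) + (\max_(z <- s) cdist z0 z))%N => x x'.
have [g [z [gi zs <-]]] := FP x; have [g' [z' [gi' zs' <-]]] := FP x'.
exists (g' z).
  have -> : cdist (g' z') (g' z) = cdist z' z.
    by apply/eqP; rewrite -(eqr_nat R) -!vdistE; apply/eqP; case: gi'.
  apply: leq_trans (cdist_triangle z0 _ _) _; rewrite leq_add//.
    by rewrite cdist_sym; apply: leq_bigmax_seq.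
  exact: leq_bigmax_seq.
move=> n; apply: balls_iso_trans (is_isometry_balls_iso n z gi').
exact: balls_iso_sym (is_isometry_balls_iso n z gi).
Qed.

Lemma balls_iso_degree (X Y : graph) n D (x : X) (y : Y) :
  (1 <= n)%N -> balls_iso n x y -> degree_le D x -> degree_le D y.
Proof.
move=> n1 [phi [psi iso]] [s sD sx]; have [[xy yx] phiP psiP adjP] := iso.
exists (map phi s); first by rewrite size_map.
have yn v : adj y v -> (cdist y v <= n)%N by move=> /cdist_adj/leq_trans; apply.
move=> v yv; have [xv <-] := psiP _ (yn _ yv).
rewrite map_f// sx// -yx; have [_ _ _ ->] := ball_isom_sym iso => //.
  by rewrite cdistxx.
exact: yn.
Qed.

Lemma cobounded_degree C (X : graph) : cobounded C X ->
  exists D, forall x : X, degree_le D x.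
Proof.
move=> XC; have [x0 _] := vertex_inh X; exists (size (ball_seq x0 C.+1)) => x.
have [y x0y xy] := XC x x0.
apply: (@balls_iso_degree _ _ 1 _ y) => //; first exact: balls_iso_sym.
exists (ball_seq x0 C.+1) => // z yz; rewrite mem_ball_seq.
by apply: leq_trans (cdist_adj_le x0 yz) _.
Qed.

Section Covering.
Context (X Z : graph) (f : X -> Z).
Hypothesis f_cov : is_covering f.

Lemma covering_adj x x' : adj x x' -> adj (f x) (f x').
Proof. by case: (f_cov.2 x) => + _ _; apply. Qed.

Lemma covering_lift n x z : (cdist (f x) z <= n)%N ->
  exists2 x', f x' = z & (cdist x x' <= n)%N.
Proof.
elim: n x => [|n ih] x.
  by rewrite leqn0 => /eqP /cdist_eq0<-; exists x => //; rewrite cdistxx.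
move=> /cdist_step[z' + zz']; case=> [e|xz'].
  by rewrite e in zz'; have [x' ? ?] := ih _ zz'; exists x' => //; apply: leqW.
have [_ _ /(_ z' xz')[x1 xx1 e]] := f_cov.2 x.
rewrite -e in zz'; have [x' <- x1x'] := ih _ zz'; exists x' => //.
by apply: leq_trans (cdist_triangle x1 _ _) _; rewrite -add1n leq_add// cdist_adj.
Qed.

(** By path lifting [f] maps the ball at [x] onto the ball at [f x], and a surjection onto a finite
    set at least as large is injective. *)
Lemma covering_inj_minimal n (x x' : X) : balls_iso n x' (f x) ->
  (size (ball_seq x n) <= size (ball_seq x' n))%N ->
  {in @ball_seq X x n &, injective f}.
Proof.
move=> /balls_iso_size_le le_x' le_x; apply: uniq_map_inj.
apply: leq_size_uniq (ball_seq_uniq (f x) n) _ _; last first.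
  by rewrite size_map (leq_trans le_x).
move=> z; rewrite mem_ball_seq => /covering_lift[u <- xu].
by rewrite map_f// mem_ball_seq.
Qed.

(* Around a vertex [x] whose ball has minimal cardinality, [f] maps the ball
   onto one with at least as many vertices, so it is injective there; by
   coboundedness every small ball lies in a translate of such a ball. *)
Lemma covering_injective C n m : cobounded C X -> (C + m <= n)%N ->
  (forall z : Z, exists x : X, balls_iso n x z) ->
  forall a b, (cdist a b <= m)%N -> f a = f b -> a = b.
Proof.
move=> XC Cm Zn a b ab.
have ex_size : exists k, `[< exists x : X, size (ball_seq x n) = k >].
  by exists (size (ball_seq a n)); apply/asboolP; exists a.
case: (ex_minnP ex_size) => k /asboolP[x0 x0k] k_min.
have [x ax x0x] := XC x0 a; have [x' x'x] := Zn (f x).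
apply: (covering_inj_minimal x'x); last 2 first.
- by rewrite mem_ball_seq cdist_sym; lia.
- by rewrite mem_ball_seq (leq_trans (cdist_triangle a _ _))// (cdist_sym x); lia.
apply: leq_trans (balls_iso_size_le (balls_iso_sym (x0x n))) _.
by rewrite x0k; apply: k_min; apply/asboolP; exists x'.
Qed.

End Covering.

(** * Discrete homotopy lifting for paths with steps of length at most [K] *)

Section CoarseLifting.
Context (X Z : graph) (f : X -> Z) (K : nat).
Hypothesis f_cov : is_covering f.
Hypothesis f_inj : forall a b, (cdist a b <= 4 * K)%N -> f a = f b -> a = b.

Definition coarse_path n (c : nat -> Z) : Prop :=
  forall i, (i < n)%N -> (cdist (c i) (c i.+1) <= K)%N.

Definition coarse_lift n (c : nat -> Z) (x : nat -> X) : Prop :=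
  (forall i, (i <= n)%N -> f (x i) = c i) /\
  forall i, (i < n)%N -> (cdist (x i) (x i.+1) <= K)%N.

Definition lift_closes n (c : nat -> Z) : Prop :=
  forall x, coarse_lift n c x -> x 0%N = x n.

Lemma coarse_lift_exists n c x0 : coarse_path n c -> f x0 = c 0%N ->
  exists2 x, coarse_lift n c x & x 0%N = x0.
Proof.
move=> c_path fx0.
pose next_lift x z := xget x [set x' | f x' = z /\ (cdist x x' <= K)%N].
have next_liftP x z : (cdist (f x) z <= K)%N ->
    f (next_lift x z) = z /\ (cdist x (next_lift x z) <= K)%N.
  move=> /(covering_lift f_cov)[x' ? ?]; rewrite /next_lift.
  by case: xgetP => [u _ //|/(_ x')[]].
pose x := fix x i := if i is j.+1 then next_lift (x j) (c i) else x0.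
have fx i : (i <= n)%N -> f (x i) = c i.
  elim: i => [//|i ih] i_lt /=.
  by have [] := @next_liftP (x i) (c i.+1) _; rewrite ?ih ?c_path// ltnW.
exists x => //; split=> // i i_lt.
by have [] := @next_liftP (x i) (c i.+1) _; rewrite ?fx ?c_path// ltnW.
Qed.

(** The lift [y] of [c' i.+1] near [x i.+1] is linked to [x' i.+1] through [x i.+1], [x i] and
    [x' i], that is by four jumps of length at most [K]. Injectivity at scale [4 * K] identifies the
    two. *)
Lemma coarse_lift_close n c c' x x' : coarse_lift n c x -> coarse_lift n c' x' ->
  (forall i, (i <= n)%N -> (cdist (c i) (c' i) <= K)%N) ->
  (cdist (x 0%N) (x' 0%N) <= K)%N ->
  forall i, (i <= n)%N -> (cdist (x i) (x' i) <= K)%N.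
Proof.
move=> [fx xK] [fx' xK'] cc' xx'; elim=> [//|i ih] i_lt.
have {}ih := ih (ltnW i_lt).
have [|y fy xy] := @covering_lift _ _ _ f_cov K (x i.+1) (c' i.+1).
  by rewrite fx// cc'.
rewrite -(@f_inj y (x' i.+1)) ?fy ?fx'//.
have := xK _ i_lt; have := xK' _ i_lt.
have := cdist_triangle (x i.+1) y (x' i.+1); have := cdist_triangle (x i) (x i.+1) (x' i.+1).
have := cdist_triangle (x' i) (x i) (x' i.+1).
rewrite (cdist_sym y (x i.+1)) (cdist_sym (x i.+1) (x i)); lia.
Qed.

(** Both ends of a lift of [c] lie within [K] of the common end of a closed lift of [c'], and they
    have the same image. *)
Lemma lift_closes_close n c c' : coarse_path n c' -> c 0%N = c n ->
  (forall i, (i <= n)%N -> (cdist (c i) (c' i) <= K)%N) ->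
  lift_closes n c' -> lift_closes n c.
Proof.
move=> c'_path c0n cc' c'_closes x x_lift.
have fx0 : f (x 0%N) = c 0%N by case: x_lift => ->.
have [|y fy xy] := @covering_lift _ _ _ f_cov K (x 0%N) (c' 0%N).
  by rewrite fx0 cc'.
have [x' x'_lift x'0] := coarse_lift_exists c'_path fy.
have close := coarse_lift_close x_lift x'_lift cc'.
have d0 : (cdist (x 0%N) (x' 0%N) <= K)%N by rewrite x'0.
have dn := close d0 n (leqnn n).
apply: f_inj; last by case: x_lift => fx _; rewrite !fx.
have := cdist_triangle (x' 0%N) (x 0%N) (x n).
rewrite (c'_closes _ x'_lift) (cdist_sym (x' n)).
by move: d0; rewrite (c'_closes _ x'_lift); lia.
Qed.

Lemma lift_closes_constant n c : (forall i, (i <= n)%N -> c i = c 0%N) ->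
  lift_closes n c.
Proof.
move=> c_const x [fx xK].
suff : forall i, (i <= n)%N -> x i = x 0%N by move=> /(_ n (leqnn n)).
elim=> [//|i ih] i_lt; rewrite -ih; last exact: ltnW.
apply: f_inj; first by rewrite cdist_sym (leq_trans (xK _ i_lt))//; lia.
by rewrite !fx// ?c_const// ltnW.
Qed.

(** The induction goes from the constant row [M], the center of the disc, outwards to the boundary
    row 0. *)
Lemma lift_closes_grid M n (c : nat -> nat -> Z) :
  (forall j, (j <= M)%N -> coarse_path n (c j)) ->
  (forall j i, (j < M)%N -> (i <= n)%N -> (cdist (c j i) (c j.+1 i) <= K)%N) ->
  (forall j, (j <= M)%N -> c j 0%N = c j n) ->
  (forall i, (i <= n)%N -> c M i = c M 0%N) ->
  lift_closes n (c 0%N).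
Proof.
move=> c_path c_close c0n c_const.
suff : forall j, (j <= M)%N -> lift_closes n (c (M - j)%N).
  by move=> /(_ M (leqnn M)); rewrite subnn.
elim=> [_|j ih] j_lt; first by rewrite subn0; apply: lift_closes_constant.
have e : (M - j = (M - j.+1).+1)%N by lia.
apply: (@lift_closes_close _ _ (c (M - j)%N)).
- by apply: c_path; lia.
- by apply: c0n; lia.
- by move=> i i_n; rewrite e; apply: c_close => //; lia.
- by apply: ih; lia.
Qed.

End CoarseLifting.

Lemma covering_bijective_balls_iso (X Z : graph) (f : X -> Z) n x :
  is_covering f -> injective f -> balls_iso n x (f x).
Proof.
move=> f_cov f_inj; have [g gK] := choice f_cov.1.
have fK u : g (f u) = u by apply: f_inj; rewrite gK.
have le u v : (cdist (f u) (f v) <= cdist u v)%N.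
  move: {2}(cdist u v) (erefl (cdist u v)) => k; elim: k v => [|k ih] v uv.
    by rewrite (cdist_eq0 uv) !cdistxx.
  have [|w wv e] := @cdist_pred _ u v; first by rewrite uv.
  apply: leq_trans (cdist_adj_le _ (covering_adj f_cov wv)) _.
  by rewrite e ltnS ih//; move: uv; rewrite e => -[].
have ge u v : (cdist u v <= cdist (f u) (f v))%N.
  by have [w /f_inj-> ] := covering_lift f_cov (leqnn (cdist (f u) (f v))).
have fE u v : cdist (f u) (f v) = cdist u v by apply/eqP; rewrite eqn_leq le ge.
exists f, g; split => [//|u|v|u v _ _].
- by rewrite fE.
- by rewrite -{1}(gK v) fE.
- by rewrite !adj_cdist fE.
Qed.

(** * Carriers in the polygonal complex *)

Lemma vertex_pt_eq (R : realType) (T : Type) (a : T) : vertex_pt R a a = 1.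
Proof. by rewrite /vertex_pt indicE mem_set. Qed.

Lemma vertex_pt_neq (R : realType) (T : Type) (a i : T) : i <> a -> vertex_pt R a i = 0.
Proof. by move=> ia; rewrite /vertex_pt indicE memNset. Qed.

Lemma vertex_pt_ge0 (R : realType) (T : Type) (a i : T) : 0 <= vertex_pt R a i.
Proof. by rewrite /vertex_pt indicE ler0n. Qed.

Section Carrier.
Variables (R : realType) (k : nat) (Y : graph).
Implicit Types (p : Pk R k Y) (u v a b : Y) (w : seq Y).

Lemma edge_coord_gt0 (T : Type) (a b i : T) (t : R) : 0 < edge_pt a b t i ->
  i = a \/ i = b.
Proof.
have [->|ia] := pselect (i = a); first by left.
have [->|ib] := pselect (i = b); first by right.
by rewrite /edge_pt !vertex_pt_neq// !mulr0 addr0 ltxx.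
Qed.

Lemma triangle_coord_gt0 (T : Type) (c a b i : T) (s t : R) :
  0 < triangle_pt c a b s t i -> [\/ i = c, i = a | i = b].
Proof.
have [->|ic] := pselect (i = c); first by move=> _; apply: Or31.
have [->|ia] := pselect (i = a); first by move=> _; apply: Or32.
have [->|ib] := pselect (i = b); first by move=> _; apply: Or33.
by rewrite /triangle_pt /edge_pt !vertex_pt_neq// !(mulr0, addr0) ltxx.
Qed.

Lemma mem_cyclic_word w w' u : cyclic_word w = cyclic_word w' -> u \in w -> u \in w'.
Proof.
move=> ww'; have : cyclic_word w' w by rewrite -ww'; exists 0%N; rewrite rot0.
by move=> [i ->]; rewrite mem_rot.
Qed.

Lemma cycle_cdist w u v : cycle (@adj Y) w -> u \in w -> v \in w ->
  (cdist u v <= size w)%N.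
Proof.
move=> w_cyc /rot_to[i w' e]; rewrite -(mem_rot i) -(size_rot i w) e => vw.
move: w_cyc; rewrite -(rot_cycle i) e /= rcons_path => /andP[uw' _].
move: vw; rewrite in_cons => /orP[/eqP->|vw']; first by rewrite cdistxx.
case/splitPr: vw' uw' => p1 p2; rewrite cat_path /= => /and3P[up1 p1v _].
have := @path_cdist _ u (rcons p1 v); rewrite rcons_path up1 last_rcons.
by move=> /(_ p1v)/leq_trans; apply; rewrite size_rcons size_cat /=; lia.
Qed.

(** Checked on each kind of cell: some coordinate is positive, and two vertices of a polygon are at
    most [k] apart. The bound [k.+1] also covers edges when [k] is 0. *)
Lemma carrier_bounded p : (exists u, carrier p u) /\
  forall u v, carrier p u -> carrier p v -> (cdist u v <= k.+1)%N.
Proof.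
case: (Pk_coordP p) => [[a pa]|[a [b [t [ab t01 pab]]]]|[w [a [[s t] [w_loop aw st pw]]]]].
- have carrE u : carrier p u -> u = a.
    move=> [|[w []]]; rewrite pa.
      have [[->]//|ua] := pselect (inl u = inl a :> Pk_index Y).
      by rewrite /Pk_vertex vertex_pt_neq// ltxx.
    by rewrite /Pk_vertex vertex_pt_neq// ltxx.
  split; last by move=> u v /carrE-> /carrE->; rewrite cdistxx.
  by exists a; left; rewrite pa /Pk_vertex vertex_pt_eq.
- have carrE u : carrier p u -> u = a \/ u = b.
    move=> [pos|[w [pos _]]]; rewrite pab /Pk_edge in pos; have := edge_coord_gt0 pos.
      by move=> [[->]|[->]]; [left|right].
    by move=> [].
  split; last first.
    have := cdist_adj ab; have := cdist_adj ab; rewrite {1}cdist_sym => ba1 ab1.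
    by move=> u v /carrE uE /carrE vE; case: uE => ->; case: vE => ->; rewrite ?cdistxx//; lia.
  move: t01; rewrite /= in_itv/= => /andP[t0 t1].
  have [t0'|t0'] := ltP 0 t; [exists b|exists a]; left; rewrite pab.
    rewrite /Pk_edge /edge_pt vertex_pt_eq mulr1 ltr_pwDr// mulr_ge0 ?vertex_pt_ge0//.
    by rewrite subr_ge0.
  have -> : t = 0 by apply/eqP; rewrite eq_le t0 t0'.
  by rewrite /Pk_edge /edge_pt vertex_pt_eq mul0r addr0 subr0 mulr1.
- have [/andP[_ wk] w_uniq w_cyc] := w_loop.
  have carrE u : carrier p u -> u \in w.
    move=> [pos|[w' [pos uw']]]; rewrite pw /Pk_triangle in pos;
      have := triangle_coord_gt0 pos => -[] // [].
    + by move->.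
    + by move->; rewrite mem_next.
    + by move/mem_cyclic_word; apply.
  split; last first.
    move=> u v /carrE uw /carrE vw; apply: leq_trans (cycle_cdist w_cyc uw vw) _.
    exact: leqW.
  move: st => [/=]; rewrite !in_itv/= => /andP[s0 s1] /andP[t0 t1].
  have [s0'|s0'] := ltP 0 s.
    exists a; right; exists w; split=> //; rewrite pw /Pk_triangle.
    rewrite /triangle_pt vertex_pt_eq mulr1 /=.
    by rewrite /edge_pt !vertex_pt_neq// !(mulr0, addr0).
  have sE : s = 0 by apply/eqP; rewrite eq_le s0 s0'.
  have [t0'|t0'] := ltP 0 t; [exists (next w a)|exists a]; left;
    rewrite pw /Pk_triangle /= sE /triangle_pt mul0r add0r subr0 mul1r /edge_pt vertex_pt_eq.
    by rewrite mulr1 ltr_pwDr// mulr_ge0 ?vertex_pt_ge0// subr_ge0.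
  have -> : t = 0 by apply/eqP; rewrite eq_le t0 t0'.
  by rewrite mul0r addr0 subr0 mulr1.
Qed.

Lemma carrier_neq0 p : exists u, carrier p u.
Proof. by exact: (carrier_bounded p).1. Qed.

Lemma carrier_diam p u v : carrier p u -> carrier p v -> (cdist u v <= k.+1)%N.
Proof. exact: (carrier_bounded p).2. Qed.

Lemma open_gt0_continuous (T : topologicalType) (g : T -> R) : continuous g ->
  open [set z | 0 < g z].
Proof.
move=> g_cont; apply: (@open_comp _ _ g [set x | 0 < x]) => [z _|]; first exact: g_cont.
exact: open_gt.
Qed.

Lemma Pk_preimage_open (T : topologicalType) (D : set T) (phi : T -> Pk_index Y -> R)
    (S : set (Pk R k Y)) (S' : set T) : open S' ->
  (forall z, D z -> Pk_points k (phi z)) ->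
  (forall z p, D z -> Pk_coord p = phi z -> S p <-> S' z) ->
  open (Pk_preimage phi S : set (subspace D)).
Proof.
move=> S'_open phiD SS'; apply/open_subspaceP; exists S' => //.
apply/seteqP; split=> z [].
  by move=> S'z Dz; split=> //; exists (MkPk (phiD _ Dz)) => //; exact/(SS' z (MkPk (phiD _ Dz)) Dz erefl).
by move=> [p Sp pz] Dz; split=> //; exact/(SS' z p Dz pz).
Qed.

(** These sets are the open stars of the vertices: on each closed cell, membership is positivity of
    continuous coordinate functions. *)
Lemma carrier_open u : open [set p : Pk R k Y | carrier p u].
Proof.
split=> [a b ab|w a w_loop aw].
- apply: (@Pk_preimage_open _ _ _ _ [set t | 0 < Pk_edge a b t (inl u)]).
  + apply: open_gt0_continuous => t; rewrite /Pk_edge /edge_pt.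
    apply: cvgD; apply: cvgMl; last exact: cvg_id.
    by apply: cvgB; [exact: cvg_cst|exact: cvg_id].
  + by move=> t t01; apply: Or32; exists a, b, t.
  + move=> t p t01 pE; split=> [[|[w []]]|]; rewrite /= -?pE//; last by left.
    by rewrite pE /Pk_edge => pos; have [] := edge_coord_gt0 pos.
(* On a triangle [u] belongs to the carrier if its own weight is positive, or if the weight [z.1] of
   the apex is and [u] lies on the polygon; the factor [(u \in w)%:R] encodes the latter
   condition. *)
- apply: (@Pk_preimage_open _ _ _ _ ([set z | 0 < Pk_triangle w a z (inl u)] `|`
     [set z | 0 < z.1 * (u \in w)%:R])).
  + apply: openU; apply: open_gt0_continuous => z.
      rewrite /Pk_triangle /triangle_pt /edge_pt; apply: cvgD.
        by apply: cvgMl; exact: cvg_fst.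
      apply: cvgM; first by apply: cvgB; [exact: cvg_cst|exact: cvg_fst].
      apply: cvgD; apply: cvgMl; last exact: cvg_snd.
      by apply: cvgB; [exact: cvg_cst|exact: cvg_snd].
    by apply: cvgMl; exact: cvg_fst.
  + by move=> z zI; apply: Or33; exists w, a, z.
  + move=> z p zI pE; split=> [[|[w' []]]|[]]; rewrite /= -?pE//.
    * by left.
    * rewrite pE => pos uw'; right => /=.
      have [[e]|//|//] := triangle_coord_gt0 pos.
      rewrite (mem_cyclic_word e uw') mulr1; move: pos; rewrite /Pk_triangle /triangle_pt e.
      by rewrite vertex_pt_eq /edge_pt !vertex_pt_neq// !(mulr0, addr0) mulr1.
    * by left.
    * case uw: (u \in w); rewrite ?mulr0 ?ltxx// mulr1 => z0; right; exists w; split=> //.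
      rewrite pE /Pk_triangle /triangle_pt vertex_pt_eq /edge_pt !vertex_pt_neq//.
      by rewrite !(mulr0, addr0) mulr1.
Qed.

End Carrier.

(** * Discretization of discs *)

Section Discretization.
Variables (R : realType) (k : nat) (Y : graph).

(* A Lebesgue number for the cover of the disc by preimages of open stars. *)
Lemma uniform_carrier (D : set (R * R)) (H : R * R -> Pk R k Y) :
  compact D -> {within D, continuous H} ->
  exists N : nat, forall z z', D z -> D z' ->
    `|z.1 - z'.1| < N.+1%:R^-1 -> `|z.2 - z'.2| < N.+1%:R^-1 ->
    exists2 u, carrier (H z) u & carrier (H z') u.
Proof.
move=> /compact_near_coveringP/near_covering_withinP D_cov /subspace_continuousP H_cont.
pose P (N : nat) (z : R * R) := forall z', D z' ->
    `|z.1 - z'.1| < N.+1%:R^-1 -> `|z.2 - z'.2| < N.+1%:R^-1 ->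
    exists2 u, carrier (H z) u & carrier (H z') u.
have [|N _ PN] := D_cov nat \oo P _ _; last first.
  by exists N => z z' Dz; apply: (PN N (leqnn N)).
move=> z0 Dz0; have [u z0u] := carrier_neq0 (H z0).
have : \forall z \near z0, D z -> carrier (H z) u.
  have := H_cont z0 Dz0 [set p | carrier p u]; apply.
  by apply: open_nbhs_nbhs; split=> //; exact: carrier_open.
move=> /nbhs_ballP[e /= e0 ball_e].
have e2 : 0 < e / 2 by rewrite divr_gt0.
near=> z N => /= Dz z' Dz' d1 d2.
have [b1 b2] : ball z0 (e / 2) z by near: z; apply: nbhsx_ballx.
have Ne : N.+1%:R^-1 < e / 2 by near: N; exact: near_infty_natSinv_lt (PosNum e2).
exists u; apply: ball_e => //.
  by split; [apply: le_ball b1|apply: le_ball b2]; rewrite ler_pdivrMr// ler_peMr ?ltW ?ltr1n.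
rewrite [e]splitr; split; [apply: ball_triangle b1 _|apply: ball_triangle b2 _];
  exact: lt_trans Ne.
Unshelve. all: by end_near. Qed.

(** The weight of the last vertex passed is 1 minus the fractional part of [s], hence positive. *)
Lemma walk_pt_carrier (x : Y) (p : seq Y) (s : R) (q : Pk R k Y) : 0 <= s ->
  Pk_coord q = walk_pt (inl x : Pk_index Y) (map inl p) s ->
  carrier q (nth x (x :: p) (Num.truncn s)).
Proof.
move=> s0 qE; left; rewrite qE /walk_pt.
have nthE i : nth (inl x : Pk_index Y) (inl x :: map inl p) i = inl (nth x (x :: p) i).
  rewrite -[inl x :: _]/(map inl (x :: p)).
  have [ip|ip] := ltnP i (size (x :: p)); first by rewrite (nth_map x).
  by rewrite !nth_default// size_map.
rewrite !nthE; set t := s - _; rewrite /edge_pt vertex_pt_eq mulr1.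
have /andP[t0 t1] := truncn_itv s0.
rewrite ltr_pwDl//; first by rewrite subr_gt0 /t ltrBlDl natr1.
by rewrite mulr_ge0 ?vertex_pt_ge0// subr_ge0.
Qed.

Lemma truncn_natrdiv i N : (0 < N)%N -> Num.truncn (i%:R / N%:R : R) = (i %/ N)%N.
Proof.
move=> N0; have NR : 0 < N%:R :> R by rewrite ltr0n.
apply/truncn_def/andP; split.
  by rewrite ler_pdivlMr// -natrM ler_nat leq_trunc_div.
by rewrite ltr_pdivrMr// -natrM ltr_nat ltn_ceil.
Qed.

(** The disc is sampled on a fine grid and each sample replaced by a vertex of its carrier.
    Neighboring samples have carriers sharing a vertex, each of diameter at most [k.+1], whence
    steps of at most [2 * k.+1]. *)
Lemma disc_grid (x : Y) (p : seq Y) L : last x p = x -> bounds_disc R k x p L ->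
  exists N (c : nat -> nat -> Y), let n := (size p * N)%N in [/\ (0 < N)%N,
    forall j i, (j <= N)%N -> (i <= n)%N -> (cdist x (c j i) <= L)%N,
    (forall j i, (j <= N)%N -> (i < n)%N -> (cdist (c j i) (c j i.+1) <= 2 * k.+1)%N) /\
    (forall j i, (j < N)%N -> (i <= n)%N -> (cdist (c j i) (c j.+1 i) <= 2 * k.+1)%N),
    (forall j, (j <= N)%N -> c j 0%N = c j n) /\
    (forall i, (i <= n)%N -> c N i = c N 0%N) &
    forall i, (i <= n)%N -> c 0%N i = nth x (x :: p) (i %/ N)].
Proof.
move=> px [H [H_cont H_walk H_side H_center H_diam]].
have [|N0 N0P] := uniform_carrier _ H_cont.
  by apply: compact_setX; exact: segment_compact.
(* One more than [N0.+1], so that a grid step is strictly below the Lebesgue number. *)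
pose N := N0.+2; pose n := (size p * N)%N.
pose pt j i : R * R := (i%:R / N%:R, j%:R / N%:R).
have N_gt0 : (0 < N)%N by [].
have NR : 0 < N%:R :> R by rewrite ltr0n.
have step_lt m : `|m%:R / N%:R - m.+1%:R / N%:R| < N0.+1%:R^-1 :> R.
  rewrite -mulrBl -natr1 opprD addrA subrr add0r mulN1r normrN gtr0_norm ?invr_gt0//.
  by rewrite ltf_pV2 ?posrE ?ltr0n// ltr_nat.
have N0_gt0 : 0 < N0.+1%:R^-1 :> R by rewrite invr_gt0 ltr0n.
have nE : n%:R / N%:R = (size p)%:R :> R by rewrite /n natrM mulfK// gt_eqF.
have ptI i : (i <= n)%N -> 0 <= (i%:R / N%:R : R) <= (size p)%:R.
  move=> i_n; rewrite divr_ge0//= -nE ler_pM2r ?invr_gt0// ler_nat//.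
have ptJ j : (j <= N)%N -> 0 <= (j%:R / N%:R : R) <= 1.
  by move=> j_N; rewrite divr_ge0//= ler_pdivrMr// mul1r ler_nat.
have Dpt j i : (j <= N)%N -> (i <= n)%N ->
    (`[0, (size p)%:R]%classic `*` `[0, 1]%classic) (pt j i).
  by move=> /ptJ j_N /ptI i_n; split; rewrite /= in_itv.
(* The choice depends on the point of the complex and not on the grid indices, so equal points get
   equal vertices: this closes the rows with [j > 0] and makes the last row constant. *)
pose u (q : Pk R k Y) := xget x (carrier q : set Y).
have uP (q : Pk R k Y) : carrier q (u q).
  by have [v qv] := carrier_neq0 q; rewrite /u; case: xgetP => [//|/(_ v)].
(* Row 0 takes the vertices of the walk itself, since [u] could pick another vertex of the carrier;
   the walk is sampled [N] times per unit of time. *)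
pose c j i := if j is 0 then nth x (x :: p) (i %/ N) else u (H (pt j i)).
have cP j i : (j <= N)%N -> (i <= n)%N -> carrier (H (pt j i)) (c j i).
  move=> j_N i_n; case: j j_N => [_|j _]; last exact: uP.
  have /andP[i0 _] := ptI _ i_n.
  rewrite /c -(truncn_natrdiv i N_gt0); apply: walk_pt_carrier => //.
  by rewrite /pt mul0r H_walk// ptI.
have close j i j' i' : (j <= N)%N -> (i <= n)%N -> (j' <= N)%N -> (i' <= n)%N ->
    `|i%:R / N%:R - i'%:R / N%:R| < N0.+1%:R^-1 :> R ->
    `|j%:R / N%:R - j'%:R / N%:R| < N0.+1%:R^-1 :> R ->
    (cdist (c j i) (c j' i') <= 2 * k.+1)%N.
  move=> jN i_n j'N i'n d1 d2.
  have [v v1 v2] := N0P (pt j i) (pt j' i') (Dpt _ _ jN i_n) (Dpt _ _ j'N i'n) d1 d2.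
  apply: leq_trans (cdist_triangle v _ _) _; rewrite mul2n -addnn leq_add//.
    by apply: carrier_diam (cP _ _ jN i_n) v1.
  by apply: carrier_diam v2 (cP _ _ j'N i'n).
have cx : c 0%N 0%N = x by rewrite /c div0n.
exists N, c; split => //.
- move=> j i jN i_n; rewrite -(ler_nat R) -vdistE -{1}cx.
  exact: H_diam (Dpt 0%N 0%N _ _) (Dpt j i jN i_n) (cP _ _ _ _) (cP _ _ _ _).
- split=> j i jN i_n; first by apply: close; rewrite ?subrr ?normr0// ltnW.
  by apply: close; rewrite ?subrr ?normr0// ltnW.
- split=> [j jN|i i_n].
    case: j jN => [_|j jN]; first by rewrite cx /c mulnK// -[LHS]px (last_nth x).
    by rewrite /c /pt -/n nE mul0r H_side// ptJ.
  rewrite /c /pt mulfV ?gt_eqF// mul0r.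
  by rewrite H_center ?ptI.
Qed.

End Discretization.

(** * From good neighborhoods to good balls *)

Definition iso_centers (X Y : graph) n : set Y :=
  [set y | exists x : X, balls_iso n x y].

Lemma iso_centers_degree (X Y : graph) D n (y : Y) : (0 < n)%N ->
  (forall x : X, degree_le D x) -> iso_centers X n y -> degree_le D y.
Proof. by move=> n0 XD [x xy]; apply: balls_iso_degree xy (XD x). Qed.

Lemma iso_centers_adj (X Y : graph) n (y z : Y) : (cdist y z <= 1)%N ->
  iso_centers X n.+1 y -> iso_centers X n z.
Proof.
move=> yz [x [phi [psi iso]]]; exists (psi z); exists phi, psi.
have [_ _ psiP _] := iso; have [|_ ez] := psiP z; first by lia.
have := @ball_isom_center _ _ _ n _ _ _ _ (psi z) iso; rewrite ez; apply.
by rewrite (ball_isom_dist (ball_isom_sym iso)); lia.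
Qed.

(* The lift is the walk from [a] to [last a p], slowed down by the factor [N]. *)
Lemma slow_walk_lift (X Z : graph) (f : X -> Z) K N a p (c : nat -> Z) :
  (0 < K)%N -> (0 < N)%N -> path (@adj X) a p ->
  (forall i, (i <= size p * N)%N -> c i = f (nth a (a :: p) (i %/ N))) ->
  lift_closes f K (size p * N) c -> a = last a p.
Proof.
move=> K0 N0 ap cE c_closes.
have := c_closes (fun i => nth a (a :: p) (i %/ N)).
rewrite div0n mulnK// [nth _ _ _ in RHS](_ : _ = last a p); last by rewrite (last_nth a).
apply; split=> [i i_n|i i_n]; first by rewrite cE.
rewrite divnS//; case: (N %| i.+1)%N; last by rewrite add0n cdistxx.
rewrite add1n /=; apply: leq_trans (cdist_adj _) K0.
by move/(pathP a): ap => /(_ (i %/ N)%N); apply; rewrite ltn_divLR.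
Qed.

(** * The ultraproduct of larger and larger good neighborhoods *)

Section LimitGraph.
Context (R : realType) (k : nat) (X : graph) (r0 : R) (C D N : nat).
Hypothesis r0_gt0 : 0 < r0.
Hypothesis X_rigid : LG_rigid_at r0 X.
Hypothesis X_cobounded : cobounded C X.
Hypothesis X_degree : forall x : X, degree_le D x.
Hypothesis N_ge_r0 : r0 + 1 <= N%:R :> R.
Hypothesis N_gt0 : (0 < N)%N.
Hypothesis N_ge : (C + 4 * (2 * k.+1) <= N)%N.
Variable Y : nat -> graph.
Hypothesis Y_ksc : asymptotically_k_simply_connected R k Y.

Section Ultra.
Variables (idx : nat -> nat) (base : forall m, Y (idx m)).
Hypothesis idx_ge : forall m, (m <= idx m)%N.
Hypothesis base_good : forall m z, (cdist (base m) z <= m)%N -> iso_centers X N z.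
Variables (U : set_system nat) (UU : UltraFilter U).
Hypothesis U_oo : forall A : set nat, (\forall m \near \oo, A m) -> U A.

Lemma near_ultra_ge m0 : \forall m \near U, (m0 <= m)%N.
Proof. by apply: U_oo; exists m0. Qed.

Lemma limit_degree C' : \forall m \near U, forall w : Y (idx m),
  (cdist (base m) w <= C')%N -> degree_le D w.
Proof.
apply: filterS (near_ultra_ge C') => m C'm w wC'.
apply: (iso_centers_degree N_gt0 X_degree); apply: base_good.
exact: leq_trans C'm.
Qed.

Definition limit_graph : graph := ultraproduct UU limit_degree.

(** A vertex of the limit stays at bounded distance from the base points, hence eventually inside
    the region where [N]-balls are good. *)
Lemma limit_iso (z : limit_graph) : exists x : X, balls_iso N x z.
Proof.
have [Cz zC] := bseqP (rep z).
have [m [zm mC]] := filter_ex (filterI (ultra_balls_iso N z) (near_ultra_ge Cz)).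
have [x xz] := base_good (leq_trans (zC m) mC).
by exists x; apply: balls_iso_trans xz (balls_iso_sym zm).
Qed.

Lemma limit_covered : Defs.covered_by limit_graph X.
Proof.
apply: X_rigid => z; have [x xz] := limit_iso z; exists x.
by apply: balls_iso_isometric xz; rewrite // ltW.
Qed.

Lemma limit_covering_injective (f : X -> limit_graph) : is_covering f -> injective f.
Proof.
move=> f_cov a b fab; pose K := (2 * k.+1)%N.
have f_inj a' b' : (cdist a' b' <= 4 * K)%N -> f a' = f b' -> a' = b'.
  exact: (covering_injective f_cov X_cobounded N_ge limit_iso).
have [p ap pb] := adj_conn a b; pose q := map f p.
have fq : path (@adj limit_graph) (f a) q.
  by rewrite /q path_map; apply: sub_path ap => u v; exact: covering_adj.
have [L L_disc] := Y_ksc (size p).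
have [n0 _ n0_disc] := L_disc.
(* The radius leaves room for the disc ([L]), for a geodesic between neighboring grid points ([K])
   and for the projected loop ([size p]). *)
have [m [[phi [psi iso]] n0m]] := filter_ex
  (filterI (ultra_balls_iso (L + K + size p) (f a)) (near_ultra_ge n0)).
have iso' := ball_isom_sym iso; have [[ma am] phiP psiP adjP] := iso.
have fa_nth i : (i <= size p)%N -> (cdist (f a) (nth (f a) (f a :: q) i) <= size p)%N.
  by move=> ip; apply: leq_trans (path_cdist_nth fq _) _; rewrite ?size_map.
have phi_path : path (@adj (Y (idx m))) (rep (f a) m) (map phi q).
  rewrite -ma path_map; apply/(pathP (f a)) => i; rewrite size_map => ip /=.
  have nth_q : nth (f a) q i = nth (f a) (f a :: q) i.+1 by [].
  rewrite nth_q adjP; first 1 last.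
  - by apply: leq_trans (fa_nth _ (ltnW ip)) _; exact: leq_addl.
  - by apply: leq_trans (fa_nth _ ip) _; exact: leq_addl.
  by move/(pathP (f a)): fq => /(_ i); apply; rewrite size_map.
have phi_loop : last (rep (f a) m) (map phi q) = rep (f a) m.
  by rewrite -{1}ma last_map last_map pb -fab.
have disc := n0_disc (idx m) (leq_trans n0m (idx_ge m)) _ _ phi_path phi_loop.
rewrite !size_map in disc.
have [N1 [c]] := disc_grid phi_loop (disc (leqnn _)).
rewrite !size_map => -[N1_gt0 c_dist [c_path c_close] [c_closed c_const] cE].
have psi_le j i j' i' : (j <= N1)%N -> (i <= size p * N1)%N ->
    (cdist (c j i) (c j' i') <= K)%N -> (cdist (psi (c j i)) (psi (c j' i')) <= K)%N.
  move=> jN i_n cc; rewrite (leq_trans _ cc)// (ball_isom_dist_le iso')//.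
  by have := c_dist _ _ jN i_n; lia.
rewrite -pb; apply: (@slow_walk_lift _ _ f K N1 a p (fun i => psi (c 0%N i))) => //.
  move=> i i_n; rewrite cE//.
  have ip : (i %/ N1 <= size p)%N by rewrite -(mulnK (size p) N1_gt0) leq_div2r.
  have iq : (i %/ N1 < size (f a :: q))%N by rewrite /= size_map ltnS.
  rewrite -ma -map_cons (nth_map (f a))//.
  rewrite -[f a :: q]/(map f (a :: p)) (nth_map a)//.
  have := fa_nth _ ip; rewrite -[f a :: q]/(map f (a :: p)) (nth_map a)// => h.
  by apply: (proj2 (phiP _ _)); apply: leq_trans h _; exact: leq_addl.
apply: (@lift_closes_grid _ _ f K f_cov f_inj N1 _ (fun j i => psi (c j i))).
- by move=> j jN i i_n; apply: psi_le => //; [exact: ltnW|exact: c_path].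
- by move=> j i jN i_n; apply: psi_le => //; [exact: ltnW|exact: c_close].
- by move=> j jN; rewrite c_closed.
- by move=> i i_n; rewrite c_const.
Qed.

(** The covering is bijective, hence an isomorphism, so balls at the base of the limit are balls of
    [X]; almost every ball at [base m] is isomorphic to the one in the limit. *)
Lemma limit_base_iso n : \forall m \near U, iso_centers X n (base m).
Proof.
have [f f_cov] := limit_covered.
have [x0 fx0] := f_cov.1 (ultra_base base UU : limit_graph).
have x0_iso := covering_bijective_balls_iso n x0 f_cov (limit_covering_injective f_cov).
have base_iso := ultra_balls_iso n (ultra_base base UU : limit_graph).
have base_rep := rep_base base UU.
apply: filterS2 base_iso base_rep => m iso e.
by exists x0; apply: balls_iso_trans x0_iso _; rewrite fx0 -e.
Qed.

End Ultra.

Lemma locally_good_good n : exists m, forall i (y : Y i), (m <= i)%N ->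
  (forall z, (cdist y z <= m)%N -> iso_centers X N z) -> iso_centers X n y.
Proof.
apply: contrapT => no_m.
(* The graph varies with the vertex, so each counterexample is a dependent pair; its index is at
   least [m], which lets the asymptotic hypothesis apply along the sequence. *)
have /choice[s sP] : forall m, exists s : {i & Y i}, [/\ (m <= tag s)%N,
    forall z, (cdist (tagged s) z <= m)%N -> iso_centers X N z &
    ~ iso_centers X n (tagged s)].
  move=> m; apply: contrapT => no_s; apply: no_m; exists m => i y mi y_good.
  by apply: contrapT => y_bad; apply: no_s; exists (existT (fun i => Y i : Type) i y).
have [U UU U_oo] := exists_ultrafilter.
have [m] := filter_ex (@limit_base_iso (fun m => tag (s m)) (fun m => tagged (s m))
  (fun m => let: And3 h _ _ := sP m in h) (fun m => let: And3 _ h _ := sP m in h)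
  U UU U_oo n).
by have [_ _] := sP m.
Qed.

End LimitGraph.

(** * Counting bad balls *)

Lemma size_flatten_le (T : Type) (b : nat) (ss : seq (seq T)) :
  all (fun s => size s <= b)%N ss -> (size (flatten ss) <= b * size ss)%N.
Proof.
elim: ss => [//|s ss ih] /= /andP[sb /ih le_ss].
by rewrite size_cat mulnS leq_add.
Qed.

Section Counting.
Variables (X Y : graph) (D : nat) (bad : set Y).
Hypothesis X_degree : forall x : X, degree_le D x.
Hypothesis Y_fin : finite_graph Y.
Hypothesis badP : forall y, ~ bad y -> iso_centers X 2 y.

Definition near_bad m : set Y := [set y | exists2 z, bad z & (cdist y z <= m)%N].

Lemma finite_setY (A : set Y) : finite_set A.
Proof. exact: sub_finite_set Y_fin. Qed.

(* A vertex adjacent to a good vertex has at most [D] neighbors, so each step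
   away from the bad set multiplies the number of vertices by at most [D + 1]. *)
Lemma card_near_badS m :
  (#|` fset_set (near_bad m.+1)| <= D.+1 * #|` fset_set (near_bad m)|)%N.
Proof.
(* Radius 2 at a good neighbor leaves radius 1 at [z], enough to bound its degree. Without a good
   neighbor the degree of [z] is uncontrolled, but the empty list then suffices. *)
have nbr z : exists s : seq Y, (size s <= D)%N /\
    forall y, ~ bad y -> adj y z -> y \in s.
  have [[y yz]|no_y] := pselect (exists2 y, ~ bad y & adj y z).
    move=> /cdist_adj yz1; have := iso_centers_adj yz1 (badP yz).
    move/(iso_centers_degree (isT : 0 < 1)%N X_degree) => [s sD sz].
    by exists s; split=> // y' _; rewrite adj_sym => /sz.
  by exists [::]; split=> // y y_good yz; case: no_y; exists y.
have [s sP] := choice nbr.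
pose A : seq Y := fset_set (near_bad m).
have A_in y : near_bad m y -> y \in A.
  by move=> yA; rewrite /A in_fset_set; [exact/mem_set|exact: finite_setY].
rewrite -[#|` fset_set (near_bad m)|]/(size A) -(size_map (fun z => z :: s z) A).
apply: (leq_trans _ (size_flatten_le _)); last first.
  by rewrite all_map; apply/allP => z _ /=; have [] := sP z.
apply: uniq_leq_size; first exact: fset_uniq.
move=> y; rewrite in_fset_set; last exact: finite_setY.
move=> /set_mem[z z_bad yz]; have [y_bad|y_good] := pselect (bad y).
  apply/flattenP; exists (y :: s y); last exact: mem_head.
  by apply: map_f; apply: A_in; exists y => //; rewrite cdistxx.
have [y' yy' y'z] := cdist_step yz; apply/flattenP; exists (y' :: s y').
  by apply: map_f; apply: A_in; exists z.
case: yy' => [->|yy']; first exact: mem_head.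
by rewrite in_cons; apply/orP; right; apply: (sP y').2.
Qed.

Lemma card_near_bad m :
  (#|` fset_set (near_bad m)| <= D.+1 ^ m * #|` fset_set bad|)%N.
Proof.
elim: m => [|m ih].
  rewrite expn0 mul1n; apply: fsubset_leq_card; rewrite -fset_set_sub.
  - by move=> y [z z_bad]; rewrite leqn0 => /eqP /cdist_eq0->.
  - exact: finite_setY.
  - exact: finite_setY.
apply: leq_trans (card_near_badS m) _.
by rewrite expnS -mulnA leq_mul2l ih orbT.
Qed.

End Counting.

Lemma card_setC_finite (Y : graph) (A : set Y) : finite_graph Y ->
  (#|` fset_set A| + #|` fset_set (~` A)| = #|` fset_set [set: Y]|)%N.
Proof.
move=> Y_fin; have fin (B : set Y) : finite_set B by exact: (finite_setY Y_fin).
rewrite -(setUv A) fset_setU// cardfsU -fset_setI// setICr fset_set0 cardfs0.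
by rewrite subn0.
Qed.

(** Centers that are bad at radius [r'] lie in the [m]-neighborhood of those bad at radius [r],
    which is at most [D.+1 ^ m] times larger. *)
Lemma good_proportion_lower (R : realType) (X Y : graph) D m (r r' : R) :
  finite_graph Y -> (forall x : X, degree_le D x) ->
  (forall y : Y, good_centers X r y -> iso_centers X 2 y) ->
  (forall y : Y, ~ good_centers X r' y ->
    exists2 z, ~ good_centers X r z & (cdist y z <= m)%N) ->
  1 - (D.+1 ^ m)%:R * (1 - good_proportion X Y r) <= good_proportion X Y r' <= 1.
Proof.
move=> Y_fin X_degree good2 bad_near; rewrite /good_proportion.
have [y0 _] := vertex_inh Y.
set n := #|` fset_set [set: Y]|.
have n0 : 0 < n%:R :> R.
  rewrite ltr0n /n cardfs_gt0; apply/fset0Pn; exists y0.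
  by rewrite in_fset_set; [exact/mem_set|exact: finite_setY].
have cr := card_setC_finite (good_centers X r) Y_fin.
have cr' := card_setC_finite (good_centers X r') Y_fin.
set g := #|` fset_set (good_centers X r)| in cr *.
set g' := #|` fset_set (good_centers X r')| in cr' *.
have le_bad : (#|` fset_set (~` good_centers X r' : set Y)| <=
    D.+1 ^ m * #|` fset_set (~` good_centers X r : set Y)|)%N.
  apply: leq_trans (card_near_bad (bad := ~` good_centers X r) X_degree Y_fin _ m).
    apply: fsubset_leq_card; rewrite -fset_set_sub; try exact: finite_setY.
    by move=> y /bad_near.
  by move=> y /contrapT /good2.
set b := #|` fset_set (~` good_centers X r)| in cr le_bad.
set b' := #|` fset_set (~` good_centers X r')| in cr' le_bad.
have crR : g%:R + b%:R = n%:R :> R by rewrite -natrD cr.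
have cr'R : g'%:R + b'%:R = n%:R :> R by rewrite -natrD cr'.
have nn : n%:R != 0 :> R by rewrite gt_eqF.
have e : 1 - g%:R / n%:R = b%:R / n%:R :> R.
  have -> : g%:R = n%:R - b%:R :> R by rewrite -crR addrK.
  by rewrite mulrBl divff// opprB addrC subrK.
have e' : g'%:R / n%:R = 1 - b'%:R / n%:R :> R.
  have -> : g'%:R = n%:R - b'%:R :> R by rewrite -cr'R addrK.
  by rewrite mulrBl divff.
rewrite e e' lerD2l lerN2 mulrA ler_pM2r ?invr_gt0// -natrM ler_nat le_bad /=.
by rewrite gerDl oppr_le0 divr_ge0.
Qed.

Theorem proposition1p11 (R : realType) (k : nat) (X : graph)
    (X_ksc : k_simply_connected R k X)
    (X_rigid : LG_rigid R X)
    (X_cocompact : cocompact R X) :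
  exists2 r : R, 0 < r &
    forall Y : nat -> graph,
      (forall n, finite_graph (Y n)) ->
      good_proportion X (Y n) r @[n --> \oo] --> (1 : R) ->
      asymptotically_k_simply_connected R k Y ->
      forall r' : R, 0 < r' ->
        good_proportion X (Y n) r' @[n --> \oo] --> (1 : R).
Proof.
have [r0 r0_gt0 X_rigid_at] := X_rigid.
have [C X_cobounded] := cocompact_cobounded X_cocompact.
have [D X_degree] := cobounded_degree X_cobounded.
pose N0 := (Num.truncn (r0 + 1)).+1.
(* The summand 2 serves the degree bounds in the counting, [N0] exceeds the rigidity scale by a
   unit, and the rest makes coverings injective at four times the grid step [2 * k.+1]. *)
pose N := (2 + (N0 + (C + 4 * (2 * k.+1))))%N.
have N_ge_r0 : r0 + 1 <= N%:R :> R.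
  apply: le_trans (ltW (truncnS_gt (r0 + 1))) _.
  by rewrite ler_nat /N -/N0 addnCA leq_addr.
(* The extra unit is the margin needed to read a combinatorial [N]-ball off a metric ball. *)
exists N.+1%:R => [|Y Y_fin Y_good Y_ksc r' r'_gt0]; first by rewrite ltr0n.
have good_iso n (y : Y n) : good_centers X (N.+1%:R : R) y -> iso_centers X N y.
  by move=> [x xy]; exists x; apply: isometric_balls_iso xy; rewrite natr1.
pose n' := (Num.truncn (r' + 1)).+1.
have n'_ge : r' + 1 <= n'%:R by rewrite ltW// truncnS_gt.
have N_ge : (C + 4 * (2 * k.+1) <= N)%N by rewrite /N addnA leq_addl.
have N_gt0 : (0 < N)%N by [].
have [m mP] := locally_good_good r0_gt0 X_rigid_at X_cobounded X_degree
  N_ge_r0 N_gt0 N_ge Y_ksc n'.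
have bad_near n : (m <= n)%N -> forall y : Y n, ~ good_centers X r' y ->
    exists2 z, ~ good_centers X (N.+1%:R : R) z & (cdist y z <= m)%N.
  move=> mn y y_bad; apply: contrapT => no_z; apply: y_bad.
  have [|x xy] := mP n y mn.
    move=> z yz; apply: good_iso; apply: contrapT => z_bad; apply: no_z.
    by exists z.
  by exists x; apply: balls_iso_isometric xy => //; exact: ltW.
have good2 n (y : Y n) : good_centers X (N.+1%:R : R) y -> iso_centers X 2 y.
  by move=> /good_iso[x /(balls_iso_le (leq_addr _ 2))]; exists x.
(* This factor does not depend on [n], so the lower bound on the proportion tends to 1. *)
pose A : R := (D.+1 ^ m)%:R.
have cvg_lower : 1 - A * (1 - good_proportion X (Y n) N.+1%:R) @[n --> \oo] --> (1 : R).
  have : 1 - A * (1 - good_proportion X (Y n) N.+1%:R) @[n --> \oo] --> 1 - A * (1 - 1).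
    by apply: cvgB; [exact: cvg_cst|apply: cvgMr; apply: cvgB => //; exact: cvg_cst].
  by rewrite subrr mulr0 subr0.
apply: (squeeze_cvgr _ cvg_lower); last exact: cvg_cst.
near=> n; apply: (good_proportion_lower (Y_fin n) X_degree (@good2 n)).
have mn : (m <= n)%N by near: n; exists m.
exact: bad_near mn.
Unshelve. all: by end_near. Qed.
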